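(* Let $n\ge 1$, let $A=\operatorname{Diag}(a_1I_{m_1},\dots,a_sI_{m_s})$ and $B=\operatorname{Diag}(b_1I_{n_1},\dots,b_tI_{n_t})$ be real $n\times n$ matrices with the $a_i$ pairwise distinct, the $b_j$ pairwise distinct, $m_i,n_j\ge 1$ and $\sum_i m_i=\sum_j n_j=n$. Let $f:O(n)\to\mathbb{R}$, $f(X)=\operatorname{Tr}(AXBX^T)$, and let $F=\{X\in O(n):(Df)(X)=0\}$ be its critical locus. Then the maps $\Phi_\epsilon$ (defined in the context) induce a diffeomorphism $$\Phi=\coprod_\epsilon\Phi_\epsilon:\ \coprod_\epsilon\big(O(\overline{m})\times O(\overline{n})\big)/O(\epsilon)\ \longrightarrow\ F$$ onto the critical locus $F\subseteq O(n)$ of $f$, where the coproduct (disjoint union) is over all perfect fillings $\epsilon$.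
   Context: $\operatorname{Diag}$ denotes a (block-)diagonal matrix. A perfect filling is an $s\times t$ matrix $\epsilon=(\epsilon_{ij})$ with entries in $\mathbb{N}=\{0,1,2,\dots\}$ such that $\sum_{j=1}^t\epsilon_{ij}=m_i$ for each $i\in\{1,\dots,s\}$ and $\sum_{i=1}^s\epsilon_{ij}=n_j$ for each $j\in\{1,\dots,t\}$. Set $O(\overline{m})=\prod_{i=1}^sO(m_i)$, $O(\overline{n})=\prod_{j=1}^tO(n_j)$, $O(\epsilon)=\prod_{i,j}O(\epsilon_{ij})$ (with $O(0)$ the trivial group). Construction of $\Phi_\epsilon$: given $Q=(Q[1],\dots,Q[s])\in O(\overline{m})$, $R=(R[1],\dots,R[t])\in O(\overline{n})$ and a perfect filling $\epsilon$, write the $m_i\times m_i$ matrix $Q[i]$ in block form $Q[i]=(Q[i,1]\ \cdots\ Q[i,t])$ with $Q[i,j]$ of size $m_i\times\epsilon_{ij}$, and the $n_j\times n_j$ matrix $R[j]$ in block form $R[j]=(R[1,j]\ \cdots\ R[s,j])$ with $R[i,j]$ of size $n_j\times\epsilon_{ij}$. Let $X[i,j]:=Q[i,j]R[i,j]^T$ (an $m_i\times n_j$ matrix), and let $\Phi_\epsilon(Q,R)$ be the $n\times n$ matrix $X$ whose $(i,j)$ block is $X[i,j]$ ($1\le i\le s$, $1\le j\le t$). The compact Lie group $O(\epsilon)$ acts smoothly and freely on the right on $O(\overline{m})\times O(\overline{n})$: for $U=(U[i,j])\in O(\epsilon)$, $(Q,R)\cdot U=(Q\cdot U,R\cdot U)$,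 where $(Q\cdot U)[i,j]=Q[i,j]U[i,j]$ and $(R\cdot U)[i,j]=R[i,j]U[i,j]$. One has $\Phi_\epsilon(Q\cdot U,R\cdot U)=\Phi_\epsilon(Q,R)$, so $\Phi_\epsilon$ descends to the quotient, which carries the unique smooth manifold structure making the quotient map a submersion. *)

(* Defs.v *)
From HB Require Import structures.
From mathcomp Require Import all_boot all_order all_algebra.
From mathcomp Require Import all_classical all_reals all_analysis.
Import Order.TTheory GRing.Theory Num.Theory numFieldNormedType.Exports.

Set Implicit Arguments.
Unset Strict Implicit.
Unset Printing Implicit Defensive.

Local Open Scope classical_set_scope.
Local Open Scope quotient_scope.
Local Open Scope ring_scope.

(* [Ck k U f] is meant for an open set [U] of a finite-dimensional space, where
   continuity of [x |-> 'd f x v] for every [v] is continuity of ['d f]. *)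
Fixpoint Ck {R : realType} {V W : normedModType R} (k : nat) (U : set V)
    (f : V -> W) : Prop :=
  if k is k'.+1 then
    (forall x, U x -> differentiable f x) /\
    (forall v, Ck k' U (fun x => 'd f x v))
  else forall x, U x -> {for x, continuous f}.

Definition smooth_on {R : realType} {V W : normedModType R} (U : set V)
  (f : V -> W) : Prop := forall k, Ck k U f.

(* A smooth structure is a maximal atlas, i.e. a set of charts.  The dimension
   belongs to the chart: the components of a manifold may have different
   dimensions.  The values of [coord] outside [dom] and of [param] outside
   [coord @` dom] are irrelevant. *)
Record chart (R : realType) (T : Type) := Chart {
  chart_dim : nat;
  dom : set T;
  coord : T -> 'rV[R]_chart_dim;
  param : 'rV[R]_chart_dim -> T }.

Arguments Chart {R T}.
Arguments coord {R T} c.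
Arguments param {R T} c.

Section Manifolds.
Context {R : realType}.

Definition codom_of {T : Type} (c : chart R T) : set 'rV[R]_(chart_dim c) :=
  coord c @` dom c.
Arguments codom_of {T} c.

Definition is_chart {T : topologicalType} (c : chart R T) : Prop :=
  [/\ open (dom c), open (codom_of c),
      forall x, dom c x -> param c (coord c x) = x,
      forall x, dom c x -> {for x, continuous (coord c)} &
      forall y, codom_of c y -> {for y, continuous (param c)}].

Definition compatible {T : Type} (c c' : chart R T) : Prop :=
  smooth_on (coord c @` (dom c `&` dom c')) (coord c' \o param c) /\
  smooth_on (coord c' @` (dom c `&` dom c')) (coord c \o param c').

Definition generated_atlas {T : topologicalType} (C : set (chart R T)) :
    set (chart R T) :=
  [set c | is_chart c /\ forall c', C c' -> compatible c c'].

Definition smooth_structure {T : topologicalType} (A : set (chart R T)) :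
    Prop :=
  [/\ hausdorff_space T /\ @second_countable T,
      A `<=` is_chart,
      forall x, exists2 c, A c & dom c x,
      forall c c', A c -> A c' -> compatible c c' &
      generated_atlas A `<=` A].

Definition smooth_map {S T : topologicalType} (A : set (chart R S))
    (B : set (chart R T)) (f : S -> T) : Prop :=
  continuous f /\
  forall c c', A c -> B c' ->
    smooth_on (coord c @` (dom c `&` f @^-1` dom c'))
              (coord c' \o f \o param c).

Definition submersion {S T : topologicalType} (A : set (chart R S))
    (B : set (chart R T)) (f : S -> T) : Prop :=
  smooth_map A B f /\
  forall x c c', A c -> B c' -> dom c x -> dom c' (f x) ->
    range ('d (coord c' \o f \o param c) (coord c x)) = setT.

Definition diffeomorphism {S T : topologicalType} (A : set (chart R S))
    (B : set (chart R T)) (f : S -> T) : Prop :=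
  smooth_map A B f /\
  exists g : T -> S, [/\ cancel f g, cancel g f & smooth_map B A g].

(* Includes the differentiability of [f] at [x]. *)
Definition critical_point {T : topologicalType} (A : set (chart R T))
    (f : T -> R) (x : T) : Prop :=
  forall c, A c -> dom c x ->
    is_diff (coord c x) ((f : T -> R^o) \o param c) 0.

(* The structure induced on [T] by a topological embedding [i] in a normed
   space: its charts are the inverses of the local parametrisations of [i @` T]
   by smooth immersions.  The image of [i] is an embedded submanifold exactly
   when these charts cover [T]. *)
Definition embedded_atlas {T : topologicalType} {E : normedModType R}
    (i : T -> E) : set (chart R T) :=
  [set c | [/\ is_chart c, smooth_on (codom_of c) (i \o param c) &
    forall y, codom_of c y -> injective ('d (i \o param c) y)]].

Definition sigT_chart {I : choiceType} {X : I -> topologicalType} (i : I)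
    (c : chart R (X i)) : chart R {i & X i} :=
  Chart (chart_dim c) (existT X i @` dom c) (untag 0 (coord c))
    (existT X i \o param c).

Definition coproduct_atlas {I : choiceType} {X : I -> topologicalType}
    (A : forall i, set (chart R (X i))) : set (chart R {i & X i}) :=
  generated_atlas (\bigcup_i (@sigT_chart I X i @` A i)).

End Manifolds.

Definition O (R : realType) (n : nat) : set 'M[R]_n :=
  [set X | X *m X^T = 1%:M].
Arguments O : clear implicits.

Definition Oprod (R : realType) (I : Type) (d : I -> nat) :
    set (prod_topology (fun i => 'M[R]_(d i))) :=
  [set Q | forall i, O R (d i) (Q i)].
Arguments Oprod R {I} d.

Definition O_atlas (R : realType) (n : nat) : set (chart R (O R n)) :=
  embedded_atlas (fun X : O R n => \val X).

Definition perfect_filling {s t : nat} (m : 'I_s -> nat) (n : 'I_t -> nat) :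
    set 'M[nat]_(s, t) :=
  [set e | (forall i, (\sum_j e i j)%N = m i) /\
           (forall j, (\sum_i e i j)%N = n j)].

Section Phi.
Context {R : realType} {s t : nat} {m : 'I_s -> nat} {n : 'I_t -> nat}.

Local Notation G := (Oprod R m * Oprod R n)%type.

(* The product structure, each factor being embedded as a group of
   block-diagonal matrices. *)
Definition G_atlas : set (chart R G) :=
  embedded_atlas (fun p : G => (\mxdiag_i \val p.1 i, \mxdiag_j \val p.2 j)).

Variable e : perfect_filling m n.

Let row_sum (i : 'I_s) : m i = (\sum_j \val e i j)%N :=
  esym ((set_valP e).1 i).
Let col_sum (j : 'I_t) : n j = (\sum_i \val e i j)%N :=
  esym ((set_valP e).2 j).

(* Q[i,j] and R[i,j], for p = (Q, R). *)
Definition Qblock (p : G) i j : 'M[R]_(m i, \val e i j) :=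
  submxrow (castmx (erefl, row_sum i) (\val p.1 i)) j.
Definition Rblock (p : G) i j : 'M[R]_(n j, \val e i j) :=
  submxrow (castmx (erefl, col_sum j) (\val p.2 j)) i.

Definition Phi {N : nat} (hm : (\sum_i m i)%N = N) (hn : (\sum_j n j)%N = N)
    (p : G) : 'M[R]_N :=
  castmx (hm, hn) (\mxblock_(i, j) (Qblock p i j *m (Rblock p i j)^T)).

Definition Oeps := Oprod R (fun ij : 'I_s * 'I_t => \val e ij.1 ij.2).

(* The relation q = p . U for some U in O(e), written blockwise. *)
Definition same_orbit (p q : G) : bool :=
  `[< exists2 U, Oeps U & forall i j,
        Qblock q i j = Qblock p i j *m U (i, j) /\
        Rblock q i j = Rblock p i j *m U (i, j) >].

Lemma same_orbit_equiv : equiv_class_of same_orbit.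
Proof.
have sym p q : same_orbit p q -> same_orbit q p.
  move=> /asboolP[U UO pq]; apply/asboolP.
  exists (fun ij => (U ij)^T).
    by move=> ij; rewrite /O /= trmxK; apply: mulmx1C; exact: UO.
  move=> i j; have UU : U (i, j) *m (U (i, j))^T = 1%:M by exact: UO.
  by have [-> ->] := pq i j; rewrite -!mulmxA UU !mulmx1.
split.
- move=> p; apply/asboolP; exists (fun=> 1%:M).
    by move=> ij; rewrite /O /= trmx1 mulmx1.
  by move=> i j; rewrite !mulmx1.
- by move=> p q; apply/idP/idP; exact: sym.
- move=> q p r /asboolP[U UO pq] /asboolP[V VO qr]; apply/asboolP.
  exists (fun ij => U ij *m V ij).
    move=> ij; rewrite /O /= trmx_mul mulmxA -(mulmxA (U ij)).
    have -> : V ij *m (V ij)^T = 1%:M by exact: VO.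
    by rewrite mulmx1; exact: UO.
  move=> i j; have [-> ->] := qr i j; have [-> ->] := pq i j.
  by rewrite !mulmxA.
Qed.

Canonical same_orbit_equivRel := EquivRelPack same_orbit_equiv.

Definition orbit_space : topologicalType :=
  quotient_topology {eq_quot same_orbit}.

Definition orbit_proj (p : G) : orbit_space := \pi_{eq_quot same_orbit} p.

(* [A] is the smooth structure making the orbit projection a submersion. *)
Definition quotient_structure (A : set (chart R orbit_space)) : Prop :=
  smooth_structure A /\ submersion G_atlas A orbit_proj.

End Phi.

Definition trace_fun {R : realType} {N : nat} (A B : 'M[R]_N) (X : O R N) : R :=
  \tr (A *m \val X *m B *m (\val X)^T).

Definition critical_locus {R : realType} {N : nat} (A B : 'M[R]_N) :
    set (O R N) :=
  [set X | critical_point (@O_atlas R N) (trace_fun A B) X].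

(* Main.v *)
Require Import Defs.
From HB Require Import structures.
From mathcomp Require Import all_boot all_order all_algebra.
From mathcomp Require Import ring lra.
From mathcomp Require Import all_classical all_reals all_analysis.

Import Order.TTheory GRing.Theory Num.Theory.
Import numFieldNormedType.Exports.

Set Implicit Arguments.
Unset Strict Implicit.
Unset Printing Implicit Defensive.

Local Open Scope classical_set_scope.
Local Open Scope ring_scope.

(** The differential of [X |-> \tr (A *m X *m B *m X^T)] at [X], in the tangent
direction [S *m X] with [S] skew, is [\tr (S *m K)], where the commutator [K] of
[X *m B *m X^T] with [A] is skew; hence [X] is critical exactly when [A]
commutes with [X *m B *m X^T] ([critical_commuteP]). As the [a i] are distinct
and the [b j] are distinct, this is a condition on the blocks [X_ij] of [X]:
different blocks in the same block row have orthogonal column spaces, and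
different blocks in the same block column have orthogonal row spaces
([commute_blocks]).

Since [X] is orthogonal, each [X_ij] is then a partial isometry, that is
[Q_ij *m R_ij^T] for orthonormal frames [Q_ij] and [R_ij]. The ranks of the
blocks form a perfect filling, because the projections [X_ij *m X_ij^T] of a
block row add up to the identity; so [X] is in the image of some [Phi]
([Phi_surjective]). The filling is determined by the ranks ([Phi_filling]), and
the frames are determined up to orthogonal changes of frame ([frames_unique]):
this is the action of the group [O(epsilon)], whence bijectivity.

The smooth structures are all obtained by embedding in a space of matrices, with
the help of one explicit construction. Near [Phi p0], polar factors of the
blocks of a critical point, multiplied by the frames of [p0], give frames
depending smoothly on the critical point: this is a smooth local section of
[Phi] through [p0], defined on an open set of matrices ([Phi_section]). Three
things follow.
- A section followed by [Phi] is a smooth retraction of an open set of matrices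
  onto the critical locus. By the inverse function theorem, smooth retracts are
  embedded manifolds ([embedded_smooth_structure]).
- The orbit projection has local sections, which implies that the structure
  induced on the orbit space by its embedding in the matrices is the only one
  for which the projection is a submersion ([quotient_structure_unique]).
- All critical points near [Phi p0] come from the same filling, so the coproduct
  of the orbit spaces is embedded in the matrices too
  ([Phi_coproduct_embedding]), with the critical locus as image.
Two manifolds embedded in the same space with the same image are diffeomorphic
([embedded_diffeomorphism]).

Polar factors are smooth because the square root of a matrix near the identity
is a local inverse of squaring ([smooth_inverse_sqrtmx]); the same polar factors
retract matrices onto the orthogonal groups ([smooth_orthogonal_retract]). *)

(* [coord] would otherwise be the coordinate functions of finite-dimensional
   vector spaces. *)
Local Notation coord := Defs.coord.

(** * Differentials *)

Section Differentials.
Context {R : realType}.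
Implicit Types V W : normedModType R.

Lemma is_diff_littleoP V W (f : V -> W) (df : {linear V -> W}) (x : V) :
  continuous df ->
  (forall e : R, 0 < e ->
     \forall h \near (0 : V), `|f (h + x) - f x - df h| <= e * `|h|) ->
  is_diff x f df.
Proof.
move=> dfc H.
have E : f \o shift x = cst (f x) + df +o_ (0 : V) id.
  apply/eqaddoP => _/posnumP[e]; have := H e%:num [gt0 of e%:num].
  by apply: filterS => h /= ?; rewrite opprD addrA.
have d := diff_unique dfc E.
apply: DiffDef => //; apply/diff_locallyP; split; first by rewrite d.
by rewrite E d.
Qed.

Lemma diff_littleo V W (f : V -> W) (x : V) (e : R) : differentiable f x ->
  0 < e -> \forall h \near (0 : V), `|f (h + x) - f x - 'd f x h| <= e * `|h|.
Proof.
move=> /diff_locally/eqaddoP + e0 => /(_ e e0).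
by apply: filterS => h /=; rewrite !opprD !addrA.
Qed.

Lemma near_is_diff V W (f g : V -> W) (x : V) (df : V -> W) :
  (\near x, f x = g x) -> is_diff x f df -> is_diff x g df.
Proof.
move=> fg [dfx <-]; apply: is_diff_littleoP; first exact: diff_continuous.
move=> e e0; have fgx : f x = g x by exact: nbhs_singleton fg.
have fg' : \forall h \near (0 : V), f (h + x) = g (h + x).
  by move: fg; rewrite (near_shift 0) /=; apply: filterS => h /=; rewrite subr0.
have := diff_littleo dfx e0; apply: filterS2 fg' => h fgh.
by rewrite -fgh -fgx.
Qed.

End Differentials.

(** * Finite-dimensional normed spaces *)

Section FiniteDimension.
Context {R : realType}.
Implicit Types V W E : normedModType R.

Lemma cvg_mx (T : Type) (F : set_system T) {FF : Filter F} m n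
    (f : T -> 'M[R]_(m, n)) (l : 'M[R]_(m, n)) :
  (forall i j, f x i j @[x --> F] --> l i j) -> f @ F --> l.
Proof.
move=> fl; apply/cvgrPdist_le => e e0.
have : \forall x \near F, forall i, forall j, `|l i j - f x i j| <= e.
  apply: filter_forall => i; apply: filter_forall => j.
  by move/cvgrPdist_le : (fl i j) => /(_ e e0).
apply: filterS => x H; rewrite /Num.Def.normr/= mx_normrE.
by rewrite (bigmax_le _ (ltW e0))// => -[i j] _; rewrite !mxE; exact: H.
Qed.

Lemma continuous_mx (T : topologicalType) m n (f : T -> 'M[R]_(m, n)) (x : T) :
  (forall i j, {for x, continuous (fun y => f y i j)}) -> {for x, continuous f}.
Proof. by move=> fx; apply: (@cvg_mx _ (nbhs x)). Qed.

Lemma cvg_bigsum (T I : Type) (F : set_system T) {FF : Filter F} V (r : seq I)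
    (P : pred I) (f : I -> T -> V) (l : I -> V) :
  (forall i, P i -> f i @ F --> l i) ->
  (\sum_(i <- r | P i) f i x) @[x --> F] --> \sum_(i <- r | P i) l i.
Proof.
move=> fl; elim: r => [|i r IH].
  by under eq_cvg do rewrite big_nil; rewrite big_nil; exact: cvg_cst.
under eq_cvg do rewrite big_cons; rewrite big_cons.
by case: ifPn => // Pi; apply: cvgD => //; exact: fl.
Qed.

Lemma linear_rV_continuous k W (f : {linear 'rV[R]_k -> W}) : continuous f.
Proof.
have fE : (f : 'rV[R]_k -> W) = fun x => \sum_i x 0 i *: f (delta_mx 0 i).
  apply/funext => x; rewrite {1}(row_sum_delta x) linear_sum.
  by apply: eq_bigr => i _; rewrite linearZ.
rewrite fE => x; apply: (@cvg_bigsum _ _ (nbhs x)) => i _.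
by apply: cvgZr_tmp; exact: coord_continuous.
Qed.

(** Finite dimensionality is expressed by linear coordinates because their
continuity, and that of their inverse, is what transports the calculus of row
vectors to matrix spaces and their products. *)
Definition findim E := exists k (u : {linear E -> 'rV[R]_k})
  (v : {linear 'rV[R]_k -> E}),
  [/\ continuous u, continuous v, cancel u v & cancel v u].

Lemma findim_rV k : findim 'rV[R]_k.
Proof. by exists k, idfun, idfun; split => // x; exact: cvg_id. Qed.

Lemma findim_mx m n : findim 'M[R]_(m, n).
Proof.
exists (m * n)%N, mxvec, vec_mx; split.
- move=> x; apply: continuous_mx => i j; rewrite ord1.
  case/mxvec_indexP: j => a b.
  rewrite (_ : (fun y => _) = fun y : 'M[R]_(m, n) => y a b); last first.
    by apply/funext => y; rewrite mxvecE.
  exact: coord_continuous.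
- exact: linear_rV_continuous.
- exact: mxvecK.
- exact: vec_mxK.
Qed.

Lemma findim_prod V W : findim V -> findim W -> findim (V * W)%type.
Proof.
move=> [k [u [v [cu cv uv vu]]]] [l [u' [v' [cu' cv' uv' vu']]]].
have cf : continuous (@fst V W) by move=> q; exact: cvg_fst.
have cs : continuous (@snd V W) by move=> q; exact: cvg_snd.
pose a (p : V * W) : 'rV[R]_(k + l) := row_mx (u p.1) (u' p.2).
pose b (x : 'rV[R]_(k + l)) : V * W := (v (lsubmx x), v' (rsubmx x)).
have la : linear a.
  by move=> c p q; rewrite /a /= !linearP scale_row_mx add_row_mx.
have lb : linear b by move=> c x y; rewrite /b !linearP.
pose A : {linear _ -> _} := HB.pack a (GRing.isLinear.Build _ _ _ _ _ la).
pose B : {linear _ -> _} := HB.pack b (GRing.isLinear.Build _ _ _ _ _ lb).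
exists (k + l)%N, A, B; split.
- move=> p; apply: continuous_mx => i j; rewrite ord1 /=.
  case: (split_ordP j) => j' ->.
    rewrite (_ : (fun y => _) = (fun x : 'rV_k => x 0 j') \o u \o fst);
      last first.
      by apply/funext => y /=; rewrite row_mxEl.
    apply: continuous_comp; first exact: cf.
    apply: continuous_comp; first exact: cu.
    exact: coord_continuous.
  rewrite (_ : (fun y => _) = (fun x : 'rV_l => x 0 j') \o u' \o snd);
    last first.
    by apply/funext => y /=; rewrite row_mxEr.
  apply: continuous_comp; first exact: cs.
    apply: continuous_comp; first exact: cu'.
  exact: coord_continuous.
- exact: linear_rV_continuous.
- by move=> [x y]; rewrite /= /a /b /= row_mxKl row_mxKr uv uv'.
- by move=> x; rewrite /= /a /b /= vu vu' hsubmxK.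
Qed.

Lemma findim_linear_continuous E W (f : {linear E -> W}) :
  findim E -> continuous f.
Proof.
move=> [k [u [v [cu cv uv vu]]]] x.
have fE : f = (f \o v) \o u :> (E -> W) by apply/funext => y /=; rewrite uv.
rewrite fE; apply: continuous_comp; first exact: cu.
exact: linear_rV_continuous.
Qed.

Lemma findim_is_diff_linear E W (f : E -> W) x :
  findim E -> linear f -> is_diff x f f.
Proof.
move=> fE lf; pose F : {linear _ -> _} :=
  HB.pack f (GRing.isLinear.Build _ _ _ _ _ lf).
rewrite -[f]/(F : _ -> _); have c := @findim_linear_continuous E W F fE.
by apply: DiffDef; [exact: linear_differentiable|rewrite diff_lin].
Qed.

Lemma is_diff_affine E W (f : E -> W) (b : W) x :
  findim E -> linear f -> is_diff x (fun y => f y + b) f.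
Proof.
move=> fE lf; have H := is_diffD (findim_is_diff_linear x fE lf) (is_diff_cst b
  x).
apply: DiffDef; first exact: (ex_diff (is_diff_def := H)).
rewrite (diff_val (is_diff_def := H)); apply/funext => y.
by rewrite /= addr0.
Qed.

End FiniteDimension.

(** * Calculus of maps of class C^k *)

Section Ck_calculus.
Context {R : realType}.
Implicit Types V W E : normedModType R.

Lemma Ck_mono V W k (U U' : set V) (f : V -> W) :
  U' `<=` U -> Ck k U f -> Ck k U' f.
Proof.
move=> U'U; elim: k f => [|k IH] f /=; first by move=> H x /U'U; exact: H.
by move=> [df H]; split=> [x /U'U|v]; [exact: df|exact: IH].
Qed.

Lemma Ck_local V W k (U : set V) (f : V -> W) :
  (forall x, U x -> exists2 U', U' x & Ck k U' f) -> Ck k U f.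
Proof.
elim: k f => [|k IH] f H /=; first by move=> x /H[U' U'x]; apply.
split=> [x /H[U' U'x [df _]]|v]; first exact: df.
by apply: IH => x /H[U' U'x [_ Hv]]; exists U' => //; exact: Hv.
Qed.

Lemma Ck_eq V W k (U : set V) (f g : V -> W) : open U ->
  (forall x, U x -> f x = g x) -> Ck k U f -> Ck k U g.
Proof.
move=> oU; elim: k f g => [|k IH] f g fg /=.
  move=> cf x Ux; have fgx : \near x, f x = g x.
    by apply: filterS (open_nbhs_nbhs (conj oU Ux)) => y /fg.
  rewrite /prop_for /continuous_at -(fg _ Ux).
  by apply: cvg_trans (cf _ Ux); exact: near_eq_cvg.
move=> [df Hf].
have dfg x : U x -> is_diff x g ('d f x).
  move=> Ux; apply: near_is_diff (differentiableP (df _ Ux)).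
  by apply: filterS (open_nbhs_nbhs (conj oU Ux)) => y /fg.
split=> [x /dfg //|v].
by apply: IH (Hf v) => x /dfg dg; rewrite (diff_val (is_diff_def := dg)).
Qed.

(** Regularity is always raised by one in this way: a formula [D] for the
differential is exhibited, and the induction hypothesis applies to it. *)
Lemma CkS V W k (U : set V) (f : V -> W) (D : V -> V -> W) : open U ->
  (forall x, U x -> is_diff x f (D x)) -> (forall v, Ck k U (D^~ v)) ->
  Ck k.+1 U f.
Proof.
move=> oU df H; split=> [x /df //|v].
by apply: Ck_eq (H v) => // x /df dfx; rewrite diff_val.
Qed.

Lemma Ck_pred V W k (U : set V) (f : V -> W) : Ck k.+1 U f -> Ck k U f.
Proof.
elim: k f => [|k IH] f [df H].
  by move=> x /df; exact: differentiable_continuous.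
by split=> // v; exact: IH.
Qed.

Lemma Ck_continuous V W k (U : set V) (f : V -> W) x :
  Ck k U f -> U x -> {for x, continuous f}.
Proof. by elim: k => [|k IH]; [exact|move/Ck_pred]. Qed.

Lemma Ck_cst V W k (U : set V) (c : W) : Ck k U (fun=> c).
Proof.
elim: k c => [|k IH] c /=; first by move=> x _; exact: cvg_cst.
split=> [x _|v]; first exact: differentiable_cst.
rewrite (_ : (fun _ => _) = fun=> 0) //; apply/funext => x.
by rewrite -/(cst c) diff_cst.
Qed.

Lemma Ck_linear E W k (U : set E) (f : E -> W) : findim E -> linear f ->
  Ck k U f.
Proof.
move=> fE lf; have df x := findim_is_diff_linear x fE lf.
case: k => [|k] /=; first by move=> x _; apply: differentiable_continuous.
split=> [x _|v] //; rewrite (_ : (fun _ => _) = fun=> f v).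
  exact: Ck_cst.
by apply/funext => x; rewrite diff_val.
Qed.

Lemma Ck_comp_linear V E W k (U : set V) (f : V -> E) (L : E -> W) :
  findim E -> linear L -> open U -> Ck k U f -> Ck k U (L \o f).
Proof.
move=> fE lL oU; have dL x := findim_is_diff_linear x fE lL.
elim: k f => [|k IH] f /=.
  move=> cf x Ux; apply: continuous_comp; first exact: cf.
  exact: differentiable_continuous.
move=> [df Hf]; apply: (@CkS _ _ _ _ _ (fun x => L \o 'd f x)) => // [x Ux|v].
  exact: is_diff_comp (differentiableP (df _ Ux)) (dL _).
exact: IH.
Qed.

Lemma Ck_add V W k (U : set V) (f g : V -> W) : open U ->
  Ck k U f -> Ck k U g -> Ck k U (fun x => f x + g x).
Proof.
move=> oU; elim: k f g => [|k IH] f g /=.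
  by move=> cf cg x Ux; apply: continuousD; [exact: cf|exact: cg].
move=> [df Hf] [dg Hg].
apply: (@CkS _ _ _ _ _ (fun x v => 'd f x v + 'd g x v)) => // [x Ux|v].
  by apply: is_diffD; apply: differentiableP; [exact: df|exact: dg].
exact: IH.
Qed.

Lemma Ck_sum V W k (U : set V) (I : Type) (r : seq I) (P : pred I)
    (f : I -> V -> W) : open U -> (forall i, P i -> Ck k U (f i)) ->
  Ck k U (fun x => \sum_(i <- r | P i) f i x).
Proof.
move=> oU Hf; elim: r => [|i r IH].
  rewrite (_ : (fun _ => _) = fun=> 0); first exact: Ck_cst.
  by apply/funext => x; rewrite big_nil.
have [Pi|Pi] := boolP (P i); last first.
  rewrite (_ : (fun _ => _) = fun x => \sum_(i <- r | P i) f i x) //.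
  by apply/funext => x; rewrite big_cons (negbTE Pi).
rewrite (_ : (fun _ => _) = fun x => f i x + \sum_(i <- r | P i) f i x).
  by apply: Ck_add => //; exact: Hf.
by apply/funext => x; rewrite big_cons Pi.
Qed.

Lemma is_diff_bilin V V1 V2 W (B : {bilinear V1 -> V2 -> W}) (f : V -> V1)
    (g : V -> V2) (df : V -> V1) (dg : V -> V2) x :
  continuous (fun p => B p.1 p.2) -> is_diff x f df -> is_diff x g dg ->
  is_diff x (fun x => B (f x) (g x)) (fun v => B (f x) (dg v) + B (df v) (g x)).
Proof.
move=> cB hf hg.
have hB : is_diff (f x, g x) (fun p : V1 * V2 => B p.1 p.2)
    (fun q => B (f x) q.2 + B q.1 (g x)).
  by apply: DiffDef; [exact: differentiable_bilin|rewrite diff_bilin].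
exact: (is_diff_comp (is_diff_pair hf hg) hB).
Qed.

Lemma Ck_bilin V V1 V2 W (B : {bilinear V1 -> V2 -> W}) k (U : set V)
    (f : V -> V1) (g : V -> V2) : continuous (fun p => B p.1 p.2) -> open U ->
  Ck k U f -> Ck k U g -> Ck k U (fun x => B (f x) (g x)).
Proof.
move=> cB oU; elim: k f g => [|k IH] f g.
  move=> cf cg x Ux.
  apply: (@continuous_comp _ _ _ (fun y => (f y, g y)) (fun p => B p.1 p.2)).
    by apply: cvg_pair; [exact: cf|exact: cg].
  exact: cB.
move=> /[dup] /Ck_pred cf [df Hf] /[dup] /Ck_pred cg [dg Hg].
apply: (@CkS _ _ _ _ _
  (fun x v => B (f x) ('d g x v) + B ('d f x v) (g x))) => // [x Ux|v].
  by apply: is_diff_bilin => //; apply: differentiableP; [exact: df|exact: dg].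
apply: Ck_add => //.
  by apply: (IH f (fun x => 'd g x v)) => //; exact: Hg.
by apply: (IH (fun x => 'd f x v) g) => //; exact: Hf.
Qed.

Lemma scaler_is_bilinear V : bilinear_for
    (GRing.Scale.Law.clone _ _ *:%R _) (GRing.Scale.Law.clone _ _ *:%R _)
    (@GRing.scale R V : R -> V -> V).
Proof.
split=> [u|u] a x y /=; first by rewrite scalerDl scalerA.
by rewrite scalerDr !scalerA mulrC.
Qed.
HB.instance Definition _ V := bilinear_isBilinear.Build R R V V _ _
  (@GRing.scale R V : R -> V -> V) (@scaler_is_bilinear V).

Lemma Ck_scale V W k (U : set V) (a : V -> R) (f : V -> W) : open U ->
  Ck k U a -> Ck k U f -> Ck k U (fun x => a x *: f x).
Proof.
move=> oU; apply: (Ck_bilin (B := @GRing.scale R W : R -> W -> W)) => //.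
exact: scale_continuous.
Qed.

End Ck_calculus.

Section Ck_composition.
Context {R : realType}.
Implicit Types V W E : normedModType R.

(** Expanding ['d f x v] in coordinates of the middle space turns the chain rule
into a finite sum of products of a coordinate of ['d f x v] with the derivative
of [g] at [f x] along a fixed vector; the induction on [k] applies to each
factor. *)
Lemma Ck_comp V E W k (U : set V) (U' : set E) (f : V -> E) (g : E -> W) :
  findim E -> open U -> open U' -> (forall x, U x -> U' (f x)) ->
  Ck k U f -> Ck k U' g -> Ck k U (g \o f).
Proof.
move=> fE oU oU' fU; have [d [c [c' [_ _ cK _]]]] := fE.
elim: k f g fU => [|k IH] f g fU.
  move=> cf cg x Ux; apply: continuous_comp; first exact: cf.
  exact/cg/fU.
move=> /[dup] /Ck_pred cf [df Hf] /[dup] /Ck_pred cg [dg Hg].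
pose e i : E := c' (delta_mx 0 i).
apply: (@CkS _ _ _ _ _ _ (fun x v =>
    \sum_i (c ('d f x v)) 0 i *: 'd g (f x) (e i))) => // [x Ux|v].
  have h := is_diff_comp (differentiableP (df _ Ux)) (differentiableP (dg _ (fU
    _ Ux))).
  apply: DiffDef; first by apply: differentiable_comp; [exact: df|exact/dg/fU].
  rewrite diff_val; apply/funext => v /=.
  rewrite -[in LHS](cK ('d f x v)) [X in c' X]row_sum_delta !linear_sum.
  by apply: eq_bigr => i _; rewrite !linearZ.
apply: Ck_sum => // i _; apply: Ck_scale => //.
  apply: (@Ck_comp_linear _ _ E R k U (fun x => 'd f x v) (fun y =>
    c y 0 i)) => //.
    by move=> a y z; rewrite linearP !mxE.
  exact: Hf.
exact: (IH f (fun y => 'd g y (e i)) fU cf (Hg _)).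
Qed.

Lemma Ck_mulr V k (U : set V) (a b : V -> R) : open U ->
  Ck k U a -> Ck k U b -> Ck k U (fun x => a x * b x : R).
Proof. by move=> oU; apply: (@Ck_scale _ _ R). Qed.

Lemma Ck_pair V W E k (U : set V) (f : V -> W) (g : V -> E) : open U ->
  Ck k U f -> Ck k U g -> Ck k U (fun x => (f x, g x)).
Proof.
move=> oU; elim: k f g => [|k IH] f g.
  by move=> cf cg x Ux; apply: cvg_pair; [exact: cf|exact: cg].
move=> [df Hf] [dg Hg].
apply: (@CkS _ _ _ _ _ _ (fun x v => ('d f x v, 'd g x v))) => // [x Ux|v].
  by apply: is_diff_pair; apply: differentiableP; [exact: df|exact: dg].
by apply: IH; [exact: Hf|exact: Hg].
Qed.

Lemma Ck_prod V k (U : set V) (I : Type) (r : seq I) (P : pred I)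
    (f : I -> V -> R) : open U -> (forall i, P i -> Ck k U (f i)) ->
  Ck k U (fun x => \prod_(i <- r | P i) f i x : R).
Proof.
move=> oU Hf; elim: r => [|i r IH].
  rewrite (_ : (fun _ => _) = fun=> 1); first exact: Ck_cst.
  by apply/funext => x; rewrite big_nil.
have [Pi|Pi] := boolP (P i); last first.
  rewrite (_ : (fun _ => _) = fun x => \prod_(i <- r | P i) f i x) //.
  by apply/funext => x; rewrite big_cons (negbTE Pi).
rewrite (_ : (fun _ => _) = fun x => f i x * \prod_(i <- r | P i) f i x).
  by apply: Ck_mulr => //; exact: Hf.
by apply/funext => x; rewrite big_cons Pi.
Qed.

Lemma Ck_inv V k (U : set V) (a : V -> R) : open U ->
  (forall x, U x -> a x != 0) -> Ck k U a -> Ck k U (fun x => (a x)^-1 : R).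
Proof.
move=> oU a0; elim: k => [|k IH].
  by move=> ca x Ux; apply: continuousV; [exact: a0|exact: ca].
move=> /[dup] /Ck_pred ca [da Ha].
apply: (@CkS _ _ _ _ _ _
    (fun x v => (- 1 * ((a x)^-1 * (a x)^-1)) * 'd a x v)) => // [x Ux|v].
  apply: DiffDef; first by apply: differentiableV; [exact: da|exact: a0].
  rewrite diffV; [|exact: da|exact: a0].
  by apply/funext => v; rewrite /= mulN1r -invfM -expr2.
apply: Ck_mulr => //; last exact: Ha.
by apply: Ck_mulr; [by []|exact: Ck_cst|apply: Ck_mulr => //; exact: IH].
Qed.

End Ck_composition.

Section Ck_matrices.
Context {R : realType}.
Implicit Types V : normedModType R.

Lemma Ck_mx V k (U : set V) m n (f : V -> 'M[R]_(m, n)) : open U ->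
  (forall i j, Ck k U (fun x => f x i j : R)) -> Ck k U f.
Proof.
move=> oU H.
rewrite (_ : f = fun x => \sum_i \sum_j f x i j *: delta_mx i j).
  by do 2 (apply: Ck_sum => // ? _); apply: Ck_scale => //; exact: Ck_cst.
by apply/funext => x; exact: matrix_sum_delta.
Qed.

Lemma Ck_entry V k (U : set V) m n (f : V -> 'M[R]_(m, n)) i j : open U ->
  Ck k U f -> Ck k U (fun x => f x i j : R).
Proof.
move=> oU; apply: (@Ck_comp_linear R V _ R k U f (fun y => y i j)) => //.
  exact: findim_mx.
by move=> a y z; rewrite !mxE.
Qed.

Lemma mulmx_continuous m n p :
  continuous (fun q : 'M[R]_(m, n) * 'M[R]_(n, p) => q.1 *m q.2).
Proof.
have fE : findim ('M[R]_(m, n) * 'M[R]_(n, p))%type.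
  by apply: findim_prod; exact: findim_mx.
move=> q; apply: continuous_mx => i j.
rewrite (_ : (fun _ => _) = fun q : 'M[R]_(m, n) * 'M[R]_(n, p) =>
  \sum_k (q.1 i k) * (q.2 k j)); last by apply/funext => y; rewrite mxE.
have H : Ck 0 setT (fun q : 'M[R]_(m, n) * 'M[R]_(n, p) =>
  \sum_k (q.1 i k) * (q.2 k j) : R).
  apply: Ck_sum => [|k _]; first exact: openT.
  apply: (@Ck_mulr _ _ 0%N setT
    (fun q : 'M[R]_(m, n) * 'M[R]_(n, p) => q.1 i k) (fun q => q.2 k j) openT).
    by apply: Ck_linear => // a y z; rewrite !mxE.
  by apply: Ck_linear => // a y z; rewrite !mxE.
exact: H.
Qed.

Lemma Ck_mulmx V k (U : set V) m n p (f : V -> 'M[R]_(m, n))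
    (g : V -> 'M[R]_(n, p)) : open U ->
  Ck k U f -> Ck k U g -> Ck k U (fun x => f x *m g x).
Proof.
by move=> oU; apply: (@Ck_bilin _ _ _ _ _ (@mulmx R m n p)) => //;
  exact: mulmx_continuous.
Qed.

Lemma is_diff_mulmx V m n p (f df : V -> 'M[R]_(m, n))
    (g dg : V -> 'M[R]_(n, p)) x : is_diff x f df -> is_diff x g dg ->
  is_diff x (fun x => f x *m g x) (fun v => f x *m dg v + df v *m g x).
Proof.
by apply: (@is_diff_bilin _ _ _ _ _ (@mulmx R m n p)); exact: mulmx_continuous.
Qed.

Lemma Ck_trmx V k (U : set V) m n (f : V -> 'M[R]_(m, n)) : open U ->
  Ck k U f -> Ck k U (fun x => (f x)^T).
Proof.
move=> oU cf; apply: Ck_mx => // i j.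
rewrite (_ : (fun _ => _) = fun x => f x j i); first exact: Ck_entry.
by apply/funext => x; rewrite mxE.
Qed.

Lemma Ck_det V k (U : set V) n (f : V -> 'M[R]_n) : open U ->
  Ck k U f -> Ck k U (fun x => \det (f x) : R).
Proof.
move=> oU cf; apply: Ck_sum => // s _; apply: Ck_mulr => //;
  first exact: Ck_cst.
by apply: Ck_prod => // i _; exact: Ck_entry.
Qed.

(** By Cramer's formula the inverse is a rational function of the entries. *)
Lemma Ck_invmx V k (U : set V) n (f : V -> 'M[R]_n) : open U ->
  (forall x, U x -> f x \in unitmx) -> Ck k U f ->
  Ck k U (fun x => invmx (f x)).
Proof.
move=> oU fU cf.
apply: (@Ck_eq _ _ _ _ _ (fun x => (\det (f x))^-1 *: \adj (f x))) => //.
  by move=> x /fU fx; rewrite /invmx fx.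
apply: Ck_scale => //.
  apply: Ck_inv => // [x /fU|]; first by rewrite unitmxE unitfE.
  exact: Ck_det.
apply: Ck_mx => // i j.
rewrite (_ : (fun _ => _) = fun x =>
  (-1) ^+ (j + i) * \det (row' j (col' i (f x)))).
  apply: Ck_mulr => //; first exact: Ck_cst.
  apply: Ck_det => //; apply: Ck_mx => // a b.
  rewrite (_ : (fun _ => _) = fun x => f x (lift j a) (lift i b)).
    exact: Ck_entry.
  by apply/funext => x; rewrite !mxE.
by apply/funext => x; rewrite mxE.
Qed.

End Ck_matrices.

(** * The inverse function theorem *)

HB.instance Definition _ (R : realType) (m n : nat) :=
  Uniform_isComplete.Build 'M[R]_(m, n) (@mx_complete R m n).

Section StrictDifferentiability.
Context {R : realType}.

Lemma mx_norm_entry m n (x : 'M[R]_(m, n)) i j : `|x i j| <= `|x|.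
Proof.
by rewrite {2}/Num.Def.normr /= mx_normrE; exact: (le_bigmax _ _ (i, j)).
Qed.

Lemma mx_norm_le m n (x : 'M[R]_(m, n)) (c : R) : 0 <= c ->
  (forall i j, `|x i j| <= c) -> `|x| <= c.
Proof.
move=> c0 H; rewrite /Num.Def.normr /= mx_normrE.
by rewrite (bigmax_le _ c0)// => -[i j] _; exact: H.
Qed.

Lemma linear_dist_le n (W : normedModType R) (L L' : {linear 'rV[R]_n -> W})
    (c : R) (v : 'rV[R]_n) : 0 <= c ->
  (forall i, `|L (delta_mx 0 i) - L' (delta_mx 0 i)| <= c) ->
  `|L v - L' v| <= n%:R * c * `|v|.
Proof.
move=> c0 H.
have LE (M : {linear 'rV[R]_n -> W}) : M v = \sum_i v 0 i *: M (delta_mx 0 i).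
  by rewrite {1}(row_sum_delta v) linear_sum; apply: eq_bigr => i _;
    rewrite linearZ.
have -> : L v - L' v =
    \sum_i v 0 i *: (L (delta_mx 0 i) - L' (delta_mx 0 i)).
  by rewrite (LE L) (LE L') -sumrB; apply: eq_bigr => i _; rewrite scalerBr.
apply: (le_trans (ler_norm_sum _ _ _)).
apply: (@le_trans _ _ (\sum_(i < n) c * `|v|)).
  apply: ler_sum => i _; rewrite normrZ mulrC.
  by rewrite ler_pM //; exact: mx_norm_entry.
by rewrite sumr_const card_ord -[leLHS]mulr_natl mulrA.
Qed.

(** The norm of a row vector is the maximum of the absolute values of its
entries, so the real mean value theorem may be applied to one entry at a time,
along the segment from [y] to [x]. *)
Lemma mean_value_bound n m (f : 'rV[R]_n -> 'rV[R]_m)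
    (df : 'rV[R]_n -> 'rV[R]_n -> 'rV[R]_m) (x y : 'rV[R]_n) (c : R) :
  (forall t : R, 0 <= t <= 1 ->
    is_diff (t *: (x - y) + y) f (df (t *: (x - y) + y))) ->
  (forall t : R, 0 <= t <= 1 -> `|df (t *: (x - y) + y) (x - y)| <= c) ->
  `|f x - f y| <= c.
Proof.
set v := x - y => hf hc.
have c0 : 0 <= c by apply: le_trans (hc 0 _); rewrite ?lexx ?ler01.
apply: mx_norm_le => // i j; rewrite (ord1 i).
pose g (t : R) := t *: v + y.
pose h (t : R) : R := f (g t) 0 j.
have dh (t : R) : 0 <= t <= 1 -> is_diff t h (fun s => s * df (g t) v 0 j).
  move=> tI.
  have dg : is_diff t g (fun s => s *: v).
    rewrite (_ : (fun s => s *: v) = (fun s : R => s *: v) + cst 0); last first.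
      by apply/funext => s; rewrite /= addr0.
    by apply: is_diffD.
  have dc := @findim_is_diff_linear _ _ R (fun z : 'rV[R]_m => z 0 j)
    (f (g t)) (findim_rV m) (fun a u w => ltac:(by rewrite /= !mxE)).
  have dfg := is_diff_comp dg (hf _ tI).
  have := is_diff_comp dfg dc.
  rewrite (_ : _ \o (f \o g) = h) // => H.
  have lf : linear (df (g t)).
    by rewrite -(diff_val (is_diff_def := hf _ tI)); exact: linearP.
  rewrite (_ : (fun s => _) = (fun z : 'rV[R]_m => z 0 j) \o (df (g t) \o
    (fun s => s *: v))) //.
  apply/funext => s /=; have lf0 : df (g t) 0 = 0.
    by rewrite -(diff_val (is_diff_def := hf _ tI)); exact: linear0.
  by have := lf s v 0; rewrite lf0 !addr0 => ->; rewrite mxE.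
have dh1 (t : R) : 0 <= t <= 1 -> is_derive t 1 h (df (g t) v 0 j).
  move=> /dh dht; apply: DeriveDef; first exact: diff_derivable.
  by rewrite deriveE // diff_val mul1r.
have ch : {within `[0, 1], continuous h}.
  apply: derivable_within_continuous => t; rewrite in_itv /= => /dh dht.
  exact: diff_derivable.
have [t|t] := @MVT_segment R h (fun t => df (g t) v 0 j) 0 1 ler01 _ ch.
  by rewrite in_itv /= => /andP[t0 t1]; apply: dh1; rewrite !ltW.
rewrite in_itv /= => /hc tI;
  rewrite /h /g scale1r subrK scale0r add0r subr0 mulr1.
rewrite !mxE => ->; exact: le_trans (mx_norm_entry _ _ _) tI.
Qed.

(** The differential stays uniformly close to its value at [x0] because it does
so on each basis vector; the mean value inequality for [f - 'd f x0] turns this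
into a Lipschitz estimate. *)
Lemma C1_strict_differentiable n m (U : set 'rV[R]_n)
    (f : 'rV[R]_n -> 'rV[R]_m) x0 (e : R) : open U -> U x0 -> Ck 1 U f ->
  0 < e -> exists d : R, [/\ 0 < d, ball x0 d `<=` U &
    forall x y, ball x0 d x -> ball x0 d y ->
      `|f x - f y - 'd f x0 (x - y)| <= e * `|x - y|].
Proof.
move=> oU Ux0 [df Cf] e0.
pose e1 : R := e / n.+1%:R.
have e10 : 0 < e1 by rewrite divr_gt0.
have : \forall z \near x0, U z /\ forall i : 'I_n,
    `|'d f z (delta_mx 0 i) - 'd f x0 (delta_mx 0 i)| <= e1.
  apply: filterI; first exact: open_nbhs_nbhs.
  apply: (@filter_forall _ _ (fun i z => `|'d f z (delta_mx 0 i) -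
    'd f x0 (delta_mx 0 i)| <= e1) (nbhs x0)) => i.
  have := Cf (delta_mx 0 i) x0 Ux0; rewrite /prop_for /continuous_at.
  move=> /cvgrPdist_le /(_ _ e10) H.
  by apply: filterS H => z Hz; rewrite -normrN opprB.
move=> /nbhs_ballP[d d0 dP]; exists d; split => //.
  by move=> z /dP[].
move=> x y bx by_.
have dle z v : ball x0 d z -> `|'d f z v - 'd f x0 v| <= e * `|v|.
  move=> /dP[_ H]; apply: (le_trans (linear_dist_le _ (ltW e10) H)).
  by rewrite ler_wpM2r // /e1 mulrCA ger_pMr // ler_pdivrMr ?mul1r ?ler_nat //.
have bg (t : R) : 0 <= t <= 1 -> ball x0 d (t *: (x - y) + y).
  move=> /andP[t0 t1]; move: bx by_; rewrite -!ball_normE /ball_ /= => bx by_.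
  have -> : x0 - (t *: (x - y) + y) = t *: (x0 - x) + (1 - t) *: (x0 - y).
    by apply/rowP => k; rewrite !mxE; ring.
  apply: (le_lt_trans (ler_normD _ _)); rewrite !normrZ (ger0_norm t0).
  rewrite (@ger0_norm _ (1 - t)) ?subr_ge0 //.
  move: bx by_; set p := `|_|; set q := `|_| => bx by_.
  have pM : p <= Num.max p q by rewrite le_max lexx.
  have qM : q <= Num.max p q by rewrite le_max lexx orbT.
  have : Num.max p q < d by rewrite gt_max bx.
  move: (Num.max p q) pM qM => M pM qM; apply: le_lt_trans; nra.
have dL z : is_diff z ('d f x0) ('d f x0).
  by apply: findim_is_diff_linear; [exact: findim_rV|exact: linearP].
have -> : f x - f y - 'd f x0 (x - y) = (f x - 'd f x0 x) - (f y - 'd f x0 y).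
  rewrite linearB; move: (f x) (f y) ('d f x0 x) ('d f x0 y) => ? ? ? ?.
  by apply/rowP => k; rewrite !mxE; ring.
apply: (@mean_value_bound _ _ (fun z => f z - 'd f x0 z)
  (fun z v => 'd f z v - 'd f x0 v)) => t tI.
- by apply: is_diffB => //; apply: differentiableP; apply: df;
  apply: (dP _ (bg _ tI)).1.
- exact/dle/bg.
Qed.

End StrictDifferentiability.

Section InverseFunctionTheorem.
Context {R : realType}.

(** Near [x0] the map [x - g x] contracts by one half. Hence differences of
points are bounded by twice the differences of their values, and [g x = y] is
solved by the fixed point of [x - g x + y]. *)
Lemma near_id_local_homeo n (U : set 'rV[R]_n) (g : 'rV[R]_n -> 'rV[R]_n) x0 :
  open U -> U x0 -> Ck 1 U g -> (forall v, 'd g x0 v = v) ->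
  exists V, [/\ open V, V x0, V `<=` U, open (g @` V) &
    forall x y, V x -> V y -> `|x - y| <= 2 * `|g x - g y|].
Proof.
move=> oU Ux0 Cg dg.
have half0 : 0 < 2^-1 :> R by rewrite invr_gt0.
have [d [d0 dU H]] := C1_strict_differentiable oU Ux0 Cg half0.
have H' x y : ball x0 d x -> ball x0 d y ->
    `|(x - g x) - (y - g y)| <= 2^-1 * `|x - y|.
  move=> bx by_; have := H _ _ bx by_; rewrite dg -normrN.
  by congr (`| _ | <= _); apply/rowP => k; rewrite !mxE; ring.
exists (ball x0 d); split => //.
- exact: ball_open.
- exact: ballxx.
- rewrite openE => _ [x1 bx1 <-].
  have [r r0 rd] : exists2 r, 0 < r & forall x, `|x1 - x| <= r -> ball x0 d x.
    have := open_nbhs_nbhs (conj (ball_open x0 d) bx1).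
    move=> /nbhs_ballP[r /= r0 rP]; exists (r / 2); first by rewrite divr_gt0.
    move=> x xr; apply: rP; rewrite -ball_normE /ball_ /=.
    by apply: (le_lt_trans xr); rewrite ltr_pdivrMr // ltr_pMr // ltr1n.
  apply/nbhs_ballP; exists (r / 2) => /=; first by rewrite divr_gt0.
  move=> y; rewrite -ball_normE /ball_ /= => gy.
  pose B := closed_ball x1 r.
  have BE : B = [set x | `|x1 - x| <= r] by rewrite /B closed_ballE.
  pose T x := x - g x + y.
  have TB : {homo T : x / B x >-> B x}.
    rewrite BE => x /= xB.
    have -> : x1 - T x = (x1 - g x1 - (x - g x)) + (g x1 - y).
      by apply/rowP => k; rewrite !mxE; ring.
    apply: (le_trans (ler_normD _ _)).
    have h1 := H' _ _ bx1 (rd _ xB).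
    have h2 : 2^-1 * `|x1 - x| <= r / 2 by rewrite mulrC ler_pM2r.
    rewrite [leRHS](splitr r); apply: lerD; last exact: ltW.
    exact: le_trans h1 h2.
  have [|||x Bx xT] := @banach_fixed_point R 'rV[R]_n B (mkfun TB).
  + exists (NngNum (ltW half0)); split => /=.
      by rewrite invf_lt1 // ltr1n.
    move=> [x x'] /= [Bx Bx']; rewrite /T.
    have -> : x - g x + y - (x' - g x' + y) = x - g x - (x' - g x').
      by apply/rowP => k; rewrite !mxE; ring.
    rewrite BE in Bx Bx'.
    exact: (H' x x' (rd _ Bx) (rd _ Bx')).
  + exact: closed_ball_closed.
  + by exists x1; rewrite BE /= subrr normr0 ltW.
  rewrite BE in Bx; exists x; first by have := rd _ Bx; rewrite -ball_normE.
  move: xT; rewrite /mkfun /T => /rowP xT; apply/rowP => k.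
  by have := xT k; rewrite !mxE; lra.
- move=> x y bx by_; have h := H' _ _ bx by_.
  have := ler_normD (x - g x - (y - g y)) (g x - g y).
  have -> : x - g x - (y - g y) + (g x - g y) = x - y.
    by apply/rowP => k; rewrite !mxE; ring.
  move: h; set p := `|x - y|; set q := `|g x - g y|.
  by set s := `|x - g x - _|; lra.
Qed.

Lemma jacobian_smooth n m (U : set 'rV[R]_n) (f : 'rV[R]_n -> 'rV[R]_m) :
  open U -> smooth_on U f -> smooth_on U (fun x => 'J f x).
Proof.
move=> oU sf k; apply: Ck_mx => // i j.
rewrite (_ : (fun _ => _) = fun x => ('d f x (delta_mx 0 i)) 0 j).
  by apply: Ck_entry => //; exact: (sf k.+1).2.
by apply/funext => x; rewrite mxE.
Qed.

(** The inverse is smooth by bootstrapping: where the jacobian is invertible,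
the differential of the inverse is the inverse jacobian read at the preimage,
hence is as regular as the inverse itself. *)
Theorem inverse_function_rV n (U : set 'rV[R]_n) (f : 'rV[R]_n -> 'rV[R]_n) x0 :
  open U -> U x0 -> smooth_on U f -> injective ('d f x0) ->
  exists V h, [/\ open V /\ open (f @` V), V x0, V `<=` U,
    forall x, V x -> h (f x) = x & smooth_on (f @` V) h].
Proof.
move=> oU Ux0 sf injf.
have sJ := jacobian_smooth oU sf.
pose U1 := U `&` [set x | 'J f x \in unitmx].
have oU1 : open U1.
  rewrite openE => x [Ux]; rewrite /= unitmxE unitfE => Jx.
  have cdet : {for x, continuous (fun x => \det ('J f x))}.
    exact: (Ck_continuous (Ck_det oU (sJ 0%N)) Ux).
  apply: filterI; first exact: open_nbhs_nbhs.
  have H := cvgr_neq0 _ cdet Jx.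
  by apply: (@filterS _ (nbhs x)) (H _) => y /=; rewrite unitmxE unitfE.
have U1x0 : U1 x0.
  split => //=; rewrite -row_free_unit; apply/inj_row_free => v.
  by rewrite /jacobian mul_rV_lin1 => vJ; apply: injf; rewrite vJ linear0.
have [J0 J0E] : exists J0, J0 = 'J f x0 by eexists.
have J0u : J0 \in unitmx by rewrite J0E; exact: U1x0.2.
pose g x := f x *m invmx J0.
have linJ : linear (fun y : 'rV[R]_n => y *m invmx J0).
  by move=> a y z; rewrite mulmxDl scalemxAl.
have Cg : Ck 1 U1 g.
  apply: Ck_mulmx => //; last exact: Ck_cst.
  by apply: Ck_mono (sf 1%N) => x [].
have dg v : 'd g x0 v = v.
  have := is_diff_comp (differentiableP ((sf 1%N).1 _ Ux0))
    (findim_is_diff_linear (f x0) (findim_rV n) linJ).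
  move=> H; rewrite (diff_val (is_diff_def := H)) /=.
  by rewrite -mul_rV_lin1 -/(jacobian f x0) -J0E -mulmxA mulmxV // mulmx1.
have [V [oV Vx0 VU1 ogV lipV]] := near_id_local_homeo oU1 U1x0 Cg dg.
have finj x y : V x -> V y -> f x = f y -> x = y.
  move=> Vx Vy fxy; apply/eqP; rewrite -subr_eq0 -normr_le0.
  by apply: le_trans (lipV _ _ Vx Vy) _; rewrite /g fxy subrr normr0 mulr0.
pose h y := xget x0 [set x | V x /\ f x = y].
have hf x : V x -> h (f x) = x.
  move=> Vx; apply: xget_unique => [|y [Vy]] //; exact: finj.
have fVE : f @` V = (fun y => y *m invmx J0) @^-1` (g @` V).
  apply/seteqP; split=> [_ [x Vx <-]|y [x Vx]] /=; first by exists x.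
  rewrite /g => /(congr1 (fun z => z *m J0));
    rewrite -!mulmxA mulVmx // !mulmx1.
  by move=> fxy; exists x.
have cJ0 : continuous (fun y : 'rV[R]_n => y *m invmx J0).
  by move=> y; exact: (Ck_continuous (Ck_linear 0 setT (findim_rV n) linJ)).
have ofV : open (f @` V).
  by rewrite fVE; apply: open_comp => // y _; exact: cJ0.
have [K K0 hK] : exists2 K : R, 0 < K &
    forall y y', (f @` V) y -> (f @` V) y' -> `|h y - h y'| <= K * `|y - y'|.
  pose L : {linear _ -> _} := HB.pack (fun y : 'rV[R]_n => y *m invmx J0)
    (GRing.isLinear.Build _ _ _ _ _ linJ).
  have [K K0 KL] := linear_lipschitz (f := L) cJ0.
  exists (2 * K); first by rewrite mulr_gt0.
  move=> _ _ [x Vx <-] [x' Vx' <-]; rewrite !hf //.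
  apply: (le_trans (lipV _ _ Vx Vx')); rewrite -mulrA ler_pM2l // /g -mulmxBl.
  exact: KL.
have dh y : (f @` V) y -> is_diff y h (fun w => w *m invmx ('J f (h y))).
  move=> fVy; have [x Vx fxy] := fVy; subst y; rewrite hf //.
  have [Ux Jx] := VU1 _ Vx; rewrite /= in Jx.
  have linJx : linear (fun y : 'rV[R]_n => y *m invmx ('J f x)).
    by move=> a y z; rewrite mulmxDl scalemxAl.
  pose L : {linear _ -> _} := HB.pack (fun y : 'rV[R]_n => y *m invmx ('J f x))
    (GRing.isLinear.Build _ _ _ _ _ linJx).
  have cL : continuous L := @findim_linear_continuous _ _ _ L (findim_rV n).
  have [C C0 CL] := linear_lipschitz (f := L) cL.
  rewrite -[fun w => _]/(L : _ -> _); apply: is_diff_littleoP => // e e0.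
  pose e1 := e / (C * K); have e10 : 0 < e1 by rewrite divr_gt0 // mulr_gt0.
  have fVk : \forall k \near (0 : 'rV[R]_n), (f @` V) (k + f x).
    have H := open_nbhs_nbhs (conj ofV fVy).
    rewrite (near_shift (f x)) /=; apply: (@filterS _ (nbhs (f x))) H => z.
    by rewrite /= sub0r subrK.
  have := diff_littleo ((sf 1%N).1 _ Ux) e10 => /nbhs_ballP[d /= d0 dP].
  have dk : \forall k \near (0 : 'rV[R]_n), `|k| < d / K.
    apply/nbhs_ballP; exists (d / K); first by rewrite /= divr_gt0.
    by move=> k; rewrite -ball_normE /ball_ /= sub0r normrN.
  apply: filterS2 fVk dk => k fVk dk.
  pose s := h (k + f x) - x.
  have sk : `|s| <= K * `|k|.
    by have := hK _ _ fVk fVy; rewrite hf // addrK.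
  have sd : ball 0 d s.
    rewrite -ball_normE /ball_ /= sub0r normrN; apply: (le_lt_trans sk).
    by rewrite mulrC -ltr_pdivlMr.
  have fsx : f (s + x) - f x = k.
    rewrite /s subrK; have [z Vz zE] := fVk.
    by rewrite -zE hf // zE addrK.
  have := dP _ sd; rewrite fsx => kJ.
  have Ls : L ('d f x s) = s.
    by rewrite /L /= -mul_rV_lin1 -/(jacobian f x) -mulmxA mulmxV // mulmx1.
  have -> : h (k + f x) - h (f x) - L k = - L (k - 'd f x s).
    by rewrite linearB Ls opprB (hf _ Vx).
  rewrite normrN; apply: (le_trans (CL _)).
  apply: (@le_trans _ _ (C * (e1 * `|s|))); first by rewrite ler_pM2l.
  apply: (@le_trans _ _ (C * (e1 * (K * `|k|)))); first by rewrite !ler_pM2l.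
  rewrite /e1 le_eqVlt; apply/orP; left; apply/eqP; field.
  by rewrite !gt_eqF.
exists V, h; split => //; first by move=> x /VU1[].
elim=> [|k IH].
  by move=> y Vy; apply: differentiable_continuous; have := dh _ Vy.
apply: (@CkS _ _ _ _ _ _ (fun y w => w *m invmx ('J f (h y)))) => // v.
apply: Ck_mulmx => //; first exact: Ck_cst.
apply: Ck_invmx => //.
  by move=> _ [x Vx <-]; rewrite hf //; have [] := VU1 _ Vx.
apply: (Ck_comp (findim_rV n) ofV oU) => //.
by move=> _ [x Vx <-]; rewrite hf //; have [] := VU1 _ Vx.
Qed.

End InverseFunctionTheorem.

Section LocalInverses.
Context {R : realType}.
Implicit Types V W E : normedModType R.

Lemma smooth_comp V E W (U : set V) (U' : set E) (f : V -> E) (g : E -> W) :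
  findim E -> open U -> open U' -> (forall x, U x -> U' (f x)) ->
  smooth_on U f -> smooth_on U' g -> smooth_on U (g \o f).
Proof. by move=> fE oU oU' fU sf sg k; exact: Ck_comp (sf k) (sg k). Qed.

Lemma smooth_linear E W (U : set E) (f : E -> W) : findim E -> linear f ->
  smooth_on U f.
Proof. by move=> fE lf k; exact: Ck_linear. Qed.

Lemma smooth_differentiable V W (U : set V) (f : V -> W) x :
  smooth_on U f -> U x -> differentiable f x.
Proof. by move=> sf Ux; exact: ((sf 1%N).1 x Ux). Qed.

Lemma smooth_continuous V W (U : set V) (f : V -> W) x :
  smooth_on U f -> U x -> {for x, continuous f}.
Proof. by move=> sf Ux; exact: ((sf 0%N) x Ux). Qed.

(* Continuity of [f] at the points of the open set [U] makes preimages open. *)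
Lemma open_preimageI (S T : topologicalType) (U : set S) (U' : set T) (f : S ->
  T) :
  open U -> open U' -> (forall x, U x -> {for x, continuous f}) ->
  open (U `&` f @^-1` U').
Proof.
move=> oU oU' cf; rewrite openE => x [Ux U'fx].
apply: filterI; first exact: open_nbhs_nbhs.
exact/(cf _ Ux)/open_nbhs_nbhs.
Qed.

Theorem inverse_function E (U : set E) (f : E -> E) x0 : findim E ->
  open U -> U x0 -> smooth_on U f -> injective ('d f x0) ->
  exists (V : set E) (h : E -> E), [/\ open V /\ open (f @` V), V x0, V `<=` U,
    forall x, V x -> h (f x) = x & smooth_on (f @` V) h].
Proof.
move=> fE oU Ux0 sf injf; have [k [u [v [cu cv uK vK]]]] := fE.
have lu := linearP u; have lv := linearP v.
pose U' := v @^-1` U.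
have oU' : open U' by apply: open_comp => // y _; exact: cv.
pose f' := u \o f \o v.
have sf' : smooth_on U' f'.
  apply: (smooth_comp fE oU' oU (f := v) (g := u \o f)) => //.
    exact: (smooth_linear _ (findim_rV k) lv).
  apply: (smooth_comp fE oU openT) => //; exact: (smooth_linear _ fE lu).
have injf' : injective ('d f' (u x0)).
  have dv := findim_is_diff_linear (u x0) (findim_rV k) lv.
  have df : is_diff (v (u x0)) f ('d f x0).
    by rewrite uK; apply: differentiableP; exact: smooth_differentiable Ux0.
  have du := findim_is_diff_linear ((f \o v) (u x0)) fE lu.
  have H := is_diff_comp (is_diff_comp dv df) du.
  rewrite (diff_val (is_diff_def := H)) => y z /= /(can_inj uK)/injf.
  exact: (can_inj vK).
have U'x0 : U' (u x0) by rewrite /U' /= uK.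
have [V' [h' [[oV' ofV'] V'x0 V'U' hf' sh']]] :=
  inverse_function_rV oU' U'x0 sf' injf'.
pose V := u @^-1` V'.
have fVE : f @` V = u @^-1` (f' @` V').
  apply/seteqP; split=> [_ [x Vx <-]|y [x Vx fxy]] /=.
    by exists (u x) => //; rewrite /f' /= uK.
  by exists (v x); [rewrite /V /= vK|apply: (can_inj uK)].
have ofV : open (f @` V) by rewrite fVE; apply: open_comp => // y _; exact: cu.
exists V, (v \o h' \o u); split => //.
- by split=> //; apply: open_comp => // y _; exact: cu.
- by move=> x /V'U'; rewrite /U' /= uK.
- by move=> x Vx /=; rewrite -[in u (f _)](uK x) -[u _]/(f' (u x)) hf' // uK.
- apply: (smooth_comp (findim_rV k) ofV ofV' (f := u)).
  + by rewrite fVE.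
  + exact: smooth_linear.
  + by apply: (smooth_comp (findim_rV k) ofV' openT) => //;
      exact: (smooth_linear _ (findim_rV k) lv).
Qed.

(** Followed by a linear left inverse of its differential, an immersion becomes
a local diffeomorphism. *)
Lemma immersion_left_inverse E d (U : set 'rV[R]_d) (phi : 'rV[R]_d -> E) y0 :
  findim E -> open U -> U y0 -> smooth_on U phi -> injective ('d phi y0) ->
  exists (V : set 'rV[R]_d) (W : set E) (l : E -> 'rV[R]_d),
    [/\ open V /\ open W, V y0, V `<=` U,
    smooth_on W l & forall y, V y -> W (phi y) /\ l (phi y) = y].
Proof.
move=> fE oU Uy0 sphi inj; have [k [u [v [cu cv uK vK]]]] := fE.
have lu := linearP u.
have dphi := differentiableP (smooth_differentiable sphi Uy0).
pose D : {linear _ -> _} := u \o 'd phi y0.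
have [K JK] : exists K, lin1_mx D *m K = 1%:M.
  apply/row_freeP/inj_row_free => w; rewrite mul_rV_lin1 /= => uw.
  by apply: inj; apply: (can_inj uK); rewrite uw !linear0.
pose uK' (x : E) := u x *m K.
have luK : linear uK'.
  by move=> a x y; rewrite /uK' linearP mulmxDl scalemxAl.
have sg : smooth_on U (uK' \o phi).
  by apply: (smooth_comp fE oU openT) => //; exact: smooth_linear.
have injg : injective ('d (uK' \o phi) y0).
  have H := is_diff_comp dphi (findim_is_diff_linear (phi y0) fE luK).
  rewrite (diff_val (is_diff_def := H)) => x y /=; rewrite /uK'.
  by rewrite -![u ('d _ _ _)]/(D _) -!mul_rV_lin1 -!mulmxA JK !mulmx1.
have [V [h [[oV ogV] Vy0 VU hg sh]]] :=
  inverse_function_rV oU Uy0 sg injg.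
pose W := uK' @^-1` ((uK' \o phi) @` V).
have cuK : continuous uK'.
  by move=> x; apply: (smooth_continuous (smooth_linear setT fE luK)).
have oW : open W by apply: open_comp => // x _; exact: cuK.
exists V, W, (h \o uK'); split => //.
  apply: (smooth_comp (findim_rV d) oW ogV) => //.
  exact: smooth_linear.
by move=> y Vy; split; [exists y|exact: hg].
Qed.

(** Restricted to an affine complement of the kernel of its differential, a
submersion becomes a local diffeomorphism. *)
Lemma submersion_right_inverse a b (U : set 'rV[R]_a) (p : 'rV[R]_a -> 'rV[R]_b)
    x0 : open U -> U x0 -> smooth_on U p -> range ('d p x0) = setT ->
  exists (W : set 'rV[R]_b) (tau : 'rV[R]_b -> 'rV[R]_a), [/\ open W, W (p x0),
    smooth_on W tau & forall z, W z -> U (tau z) /\ p (tau z) = z].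
Proof.
move=> oU Ux0 sp surj.
have dp := differentiableP (smooth_differentiable sp Ux0).
have [K KJ] : exists K, K *m 'J p x0 = 1%:M.
  apply/row_fullP; rewrite -sub1mx; apply/row_subP => i.
  have : range ('d p x0) (row i 1%:M) by rewrite surj.
  by move=> [w _ <-]; rewrite -mul_rV_lin1 submxMl.
pose c (y : 'rV[R]_b) := y *m K + x0.
have sc : smooth_on setT c.
  move=> k; apply: Ck_add; [exact: openT| |exact: Ck_cst].
  by apply: Ck_linear; [exact: findim_rV|move=> e x y;
    rewrite mulmxDl scalemxAl].
have cc y : {for y, continuous c} by exact: smooth_continuous sc _.
pose U' := c @^-1` U.
have oU' : open U' by apply: open_comp => // y _; exact: cc.
have U'0 : U' 0 by rewrite /U' /c /= mul0mx add0r.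
have sg : smooth_on U' (p \o c).
  apply: (smooth_comp (findim_rV a) oU' oU) => // k.
  by apply: Ck_mono (sc k).
have dc : is_diff (0 : 'rV[R]_b) c (fun y => y *m K).
  apply: is_diff_affine; first exact: findim_rV.
  by move=> e x y; rewrite mulmxDl scalemxAl.
have injg : injective ('d (p \o c) 0).
  have c0 : c 0 = x0 by rewrite /c mul0mx add0r.
  rewrite -c0 in dp; have H := is_diff_comp dc dp.
  rewrite (diff_val (is_diff_def := H)) c0 => x y /=.
  by rewrite -!mul_rV_lin1 -/(jacobian p x0) -!mulmxA KJ !mulmx1.
have [V [h [[oV ogV] V0 VU hg sh]]] :=
  inverse_function_rV oU' U'0 sg injg.
exists ((p \o c) @` V), (c \o h); split => //.
- by exists 0 => //=; rewrite /c mul0mx add0r.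
- apply: (smooth_comp (findim_rV b) ogV openT) => //.
- by move=> _ [y Vy <-]; rewrite /= -[p (c y)]/((p \o c) y) hg //; split=> //;
  exact: VU.
Qed.

End LocalInverses.

(** * Topological embeddings *)

Section Embeddings.
Context {R : realType}.
Implicit Types E : normedModType R.

(** The last clause says that the topology of [T] is induced by [i]. *)
Definition embedding {T E : topologicalType} (i : T -> E) : Prop :=
  [/\ continuous i, injective i &
    forall x (U : set T), nbhs x U -> \forall z \near i x, forall y, i y =
      z -> U y].

Lemma embedding_continuous (S T E : topologicalType) (i : T -> E) (f : S ->
  T) s :
  embedding i -> {for s, continuous (i \o f)} -> {for s, continuous f}.
Proof.
move=> [_ _ ind] cif U /ind/cif; rewrite nbhs_simpl /=.
by apply: (@filterS _ (nbhs s)) => y /(_ _ erefl).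
Qed.

Lemma embedding_comp (T E E' : topologicalType) (i : T -> E) (u : E -> E')
    (v : E' -> E) : continuous u -> continuous v -> cancel u v ->
  embedding i -> embedding (u \o i).
Proof.
move=> cu cv uK [ci inji ind]; split.
- by move=> x; apply: continuous_comp; [exact: ci|exact: cu].
- by move=> x y /(can_inj uK)/inji.
- move=> x U /ind H; have := cv (u (i x)); rewrite /continuous_at uK =>
  /(_ _ H).
  rewrite nbhs_simpl; apply: (@filterS _ (nbhs (u (i x)))) => z /= Hz y uyz.
  by apply: Hz; rewrite -uyz /= uK.
Qed.

Lemma embedding_hausdorff (T E : topologicalType) (i : T -> E) :
  embedding i -> hausdorff_space E -> hausdorff_space T.
Proof.
move=> [ci inji _] hE x y xy; apply: inji; apply: hE => A B Ax By.
have [z [Az Bz]] := xy _ _ (ci _ _ Ax) (ci _ _ By).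
by exists (i z).
Qed.

(** A basis is formed by the preimages of the balls with rational centre and
radius [1 / n.+1]. *)
Lemma embedding_second_countable (T : topologicalType) k (i : T -> 'rV[R]_k) :
  embedding i -> @second_countable T.
Proof.
move=> [ci inji ind].
pose c (p : 'rV[rat]_k * nat) : 'rV[R]_k := map_mx ratr p.1.
pose B (p : 'rV[rat]_k * nat) := i @^-1` ball (c p) (p.2.+1%:R^-1 : R).
exists (B @` setT).
  by apply: sub_countable (countableP setT); exact: card_image_le.
split=> [_ [p _ <-]|x U].
  by apply: open_comp => [y _|]; [exact: ci|exact: ball_open].
move=> /ind /nbhs_ballP[e /= e0 eP].
have [n ne] : exists n, n.+1%:R^-1 < e / 2.
  have [n] := near_infty_natSinv_lt (PosNum (divr_gt0 e0 (ltr0n _ 2))).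
  by move=> _ /(_ n (leqnn _)) /= ?; exists n.
have n0 : 0 < n.+1%:R^-1 :> R by rewrite invr_gt0.
have q j : {q : rat | `|ratr q - i x 0 j| < n.+1%:R^-1}.
  apply: cid; have [q] : exists q, ratr q \in `]i x 0 j - n.+1%:R^-1,
    i x 0 j + n.+1%:R^-1[.
    by apply: rat_in_itvoo; rewrite ltrBlDr -addrA ltrDl addr_gt0.
  by rewrite in_itv /= -ltr_distl => ?; exists q.
pose p : 'rV[rat]_k * nat := (\row_j sval (q j), n).
have bp : ball (c p) (p.2.+1%:R^-1 : R) (i x).
  split=> // a j.
  by rewrite (ord1 a) -ball_normE /ball_ /= !mxE; exact: svalP (q j).
exists (B p); first by split => //; exists p.
move=> y /= By; apply: (eP (i y)) => //.
apply: (@le_ball _ _ _ (n.+1%:R^-1 + n.+1%:R^-1)).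
  by rewrite (splitr e) lerD // ltW.
by apply: (ball_triangle (y := c p)) => //; exact: ball_sym.
Qed.

Lemma embedding_set_val (X : topologicalType) (A : set X) :
  embedding (fun x : A => \val x).
Proof.
split; [exact: initial_continuous|exact: val_inj|].
move=> x U [_ /= [[W oW <-] /= Wx] sWU].
apply: (@filterS _ (nbhs (\val x))) (open_nbhs_nbhs (conj oW Wx)) => z Wz y yz.
by apply: sWU; rewrite /= /set_val /= yz.
Qed.

Lemma embedding_trans (X Y Z : topologicalType) (i : X -> Y) (j : Y -> Z) :
  embedding i -> embedding j -> embedding (j \o i).
Proof.
move=> [ci inji indi] [cj injj indj]; split.
- by move=> x; apply: continuous_comp; [exact: ci|exact: cj].
- by move=> x y /injj/inji.
- move=> x U /indi/indj; apply: (@filterS _ (nbhs (j (i x)))) => z H y jiy.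
  exact: (H (i y)).
Qed.

Lemma continuous_pair (X Y X' Y' : topologicalType) (i : X -> X') (j : Y ->
  Y') :
  continuous i -> continuous j -> continuous (fun p : X * Y => (i p.1, j p.2)).
Proof.
move=> ci cj [x y]; apply: cvg_pair => /=.
  by apply: (cvg_comp _ _ cvg_fst); exact: ci.
by apply: (cvg_comp _ _ cvg_snd); exact: cj.
Qed.

Lemma embedding_pair (X Y X' Y' : topologicalType) (i : X -> X') (j : Y -> Y') :
  embedding i -> embedding j -> embedding (fun p : X * Y => (i p.1, j p.2)).
Proof.
move=> [ci inji indi] [cj injj indj]; split.
- exact: continuous_pair.
- by move=> [x y] [x' y'] /= [/inji -> /injj ->].
- move=> [x y] U [[A B] /= [xA yB] sub].
  exists ([set z | forall t, i t = z -> A t], [set z | forall t, j t = z ->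
    B t]).
    by split; [exact: indi|exact: indj].
  move=> [z w] [/= zA wB] [t s] /= [it js]; apply: (sub (t, s)).
  by split; [exact: zA|exact: wB].
Qed.

(** If a map that extends to the ambient space through [i] already induces the
topology of [X], then so does [i]. *)
Lemma embedding_left_inverse (X Y Z : topologicalType) (i : X -> Y) (k : X -> Z)
    (rho : Y -> Z) : continuous i -> (forall x, {for i x, continuous rho}) ->
  (forall x, rho (i x) = k x) -> embedding k -> embedding i.
Proof.
move=> ci crho rhoi [ck injk indk]; split=> //.
  by move=> x y ixy; apply: injk; rewrite -!rhoi ixy.
move=> x U /indk; rewrite -rhoi => /crho; rewrite nbhs_simpl /=.
by apply: (@filterS _ (nbhs (i x))) => z H y iy; apply: H; rewrite -iy rhoi.
Qed.

Lemma continuous_prod_topology (X : topologicalType) (I : Type)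
    (K : I -> topologicalType) (f : X -> prod_topology K) x :
  (forall i, {for x, continuous (fun y => f y i)}) -> {for x, continuous f}.
Proof.
move=> cf; apply/cvg_sup => i U [_ /= [[V oV <-] /= Vx] sub].
rewrite nbhs_simpl /=; apply: (@filterS _ (nbhs x) _ (fun y => V (f y i))).
  by move=> y Vy; exact: sub.
by apply: cf; exact: open_nbhs_nbhs.
Qed.

End Embeddings.

(** * Charts of embedded manifolds *)

Section Charts.
Context {R : realType}.
Implicit Types (V W E : normedModType R) (T : topologicalType).

Lemma smooth_local V W (U : set V) (f : V -> W) :
  (forall x, U x -> exists2 U', U' x & smooth_on U' f) -> smooth_on U f.
Proof. by move=> H k; apply: Ck_local => x /H[U' U'x sf]; exists U'. Qed.

Lemma smooth_eq V W (U : set V) (f g : V -> W) : open U ->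
  (forall x, U x -> f x = g x) -> smooth_on U f -> smooth_on U g.
Proof. by move=> oU fg sf k; exact: Ck_eq (sf k). Qed.

Lemma smooth_mono V W (U U' : set V) (f : V -> W) :
  U' `<=` U -> smooth_on U f -> smooth_on U' f.
Proof. by move=> UU' sf k; exact: Ck_mono (sf k). Qed.

Lemma near_left_inverse_inj V W (f : V -> W) (g : W -> V) x :
  differentiable f x -> differentiable g (f x) ->
  (\near x, g (f x) = x) -> injective ('d f x).
Proof.
move=> df dg gf.
have H : is_diff x id ('d g (f x) \o 'd f x).
  apply: (@near_is_diff _ _ _ (g \o f)) => //.
  exact: is_diff_comp (differentiableP df) (differentiableP dg).
have E v : 'd g (f x) ('d f x v) = v.
  have := diff_val (is_diff_def := H).
  by rewrite (diff_val (is_diff_def := is_diff_id x)) => /(congr1 (@^~ v)).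
exact: can_inj E.
Qed.

Lemma chart_preimage_open T (c : chart R T) (U : set T) : is_chart c ->
  open U -> open (coord c @` (dom c `&` U)).
Proof.
move=> [od ocd pk cc cp] oU.
rewrite (_ : _ @` _ = codom_of (c := c) `&` param c @^-1` U).
  exact: open_preimageI.
apply/seteqP; split=> [_ [x [dx Ux] <-]|_ [[x dx <-]]] /=.
  by split; [exists x|rewrite pk].
by rewrite pk // => Ux; exists x.
Qed.

(** The parametrisation of an embedded chart is an immersion, so it has a smooth
left inverse [l] in the ambient space, and [coord c \o f] is locally
[l \o (i \o f)]. Smoothness of maps into an embedded manifold is thus tested in
the ambient space. *)
Lemma embedded_coord_smooth T E V (i : T -> E) (c : chart R T) (U : set V)
    (f : V -> T) : findim E -> embedded_atlas i c -> open U ->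
  (forall x, U x -> {for x, continuous f}) -> (forall x, U x -> dom c (f x)) ->
  smooth_on U (i \o f) -> smooth_on U (coord c \o f).
Proof.
move=> fE [[od ocd pk cc cp] sip inj] oU cf fdom sif.
apply: smooth_local => x Ux.
have y0 : codom_of (c := c) (coord c (f x)) by exists (f x) => //; exact: fdom.
have [V' [W [l [[oV oW] Vy VU sl lK]]]] :=
  immersion_left_inverse fE ocd y0 sip (inj _ y0).
pose U' := U `&` (coord c \o f) @^-1` V'.
have oU' : open U'.
  apply: (open_preimageI oU oV) => z Uz.
  exact: (continuous_comp (cf _ Uz) (cc _ (fdom _ Uz))).
have ipf z : U z -> i (param c (coord c (f z))) = i (f z).
  by move=> Uz; rewrite pk //; exact: fdom.
exists U'; first by split.
apply: (smooth_eq (f := l \o (i \o f))) => //.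
  by move=> z [Uz Vz] /=; rewrite -ipf //; have [] := lK _ Vz.
apply: (smooth_comp fE oU' oW) => //.
  by move=> z [Uz Vz] /=; rewrite -ipf //; have [] := lK _ Vz.
by apply: smooth_mono sif => z [].
Qed.

Lemma embedded_transition_smooth T E (i : T -> E) (c c' : chart R T) :
  findim E -> embedded_atlas i c -> embedded_atlas i c' ->
  smooth_on (coord c @` (dom c `&` dom c')) (coord c' \o param c).
Proof.
move=> fE ac ac'; have [chc sc _] := ac; have [chc' _ _] := ac'.
have [od ocd pk cc cp] := chc; have [od' _ _ _ _] := chc'.
apply: (embedded_coord_smooth fE ac').
- exact: chart_preimage_open.
- by move=> _ [x [dx _] <-]; apply: cp; exists x.
- by move=> _ [x [dx dx'] <-]; rewrite pk.
- by apply: smooth_mono sc => _ [x [dx _] <-]; exists x.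
Qed.

Lemma embedded_compatible T E (i : T -> E) (c c' : chart R T) :
  findim E -> embedded_atlas i c -> embedded_atlas i c' -> compatible c c'.
Proof.
move=> fE ac ac'; split; first exact: (embedded_transition_smooth fE ac ac').
by rewrite setIC; exact: (embedded_transition_smooth fE ac' ac).
Qed.

(** A chart compatible with embedded charts covering [T] is itself embedded: in
its coordinates [i] reads as an embedded parametrisation after an invertible
change of coordinates. *)
Lemma generated_sub_embedded T E (i : T -> E) (C : set (chart R T)) :
  findim E -> C `<=` embedded_atlas i -> (forall x, exists2 c, C c & dom c x) ->
  generated_atlas C `<=` embedded_atlas i.
Proof.
move=> fE Ci cov c [chc comp].
have [od ocd pk cc cp] := chc.
have loc x : dom c x -> exists c', [/\ C c', dom c' x,
    open (coord c @` (dom c `&` dom c')) &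
    (coord c @` (dom c `&` dom c')) (coord c x)].
  move=> dx; have [c' Cc' dx'] := cov x; exists c'.
  have [[od' _ _ _ _] _ _] := Ci _ Cc'.
  by split => //; [exact: chart_preimage_open|exists x].
split=> //.
  apply: smooth_local => _ [x dx <-]; have [c' [Cc' dx' oU Ux]] := loc x dx.
  exists (coord c @` (dom c `&` dom c')) => //.
  have [[od' ocd' pk' _ _] sc' _] := Ci _ Cc'.
  apply: (smooth_eq (f := (i \o param c') \o (coord c' \o param c))) => //.
    by move=> _ [y [dy dy'] <-] /=; rewrite !(pk, pk').
  apply: (smooth_comp (findim_rV _) oU ocd').
  - by move=> _ [y [dy dy'] <-] /=; rewrite pk //; exists y.
  - exact: (comp _ Cc').1.
  - exact: sc'.
move=> _ [x dx <-]; have [c' [Cc' dx' oU Ux]] := loc x dx.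
have [[od' ocd' pk' cc' cp'] sc' inj'] := Ci _ Cc'.
have [s1 s2] := comp _ Cc'.
set y := coord c x; set t := coord c' \o param c.
have ty : t y = coord c' x by rewrite /t /y /= pk.
have d1 : differentiable t y by exact: smooth_differentiable s1 Ux.
have d2 : differentiable (coord c \o param c') (t y).
  by apply: smooth_differentiable s2 _; rewrite ty; exists x.
have nearU : \near y, (coord c @` (dom c `&` dom c')) y.
  exact: open_nbhs_nbhs.
have injt : injective ('d t y).
  apply: near_left_inverse_inj d1 d2 _.
  apply: (@filterS _ (nbhs y)) nearU => _ [z [dz dz'] <-].
  by rewrite /t /= !(pk, pk').
have d3 : differentiable (i \o param c') (t y).
  by apply: smooth_differentiable sc' _; rewrite ty; exists x.
have H : is_diff y (i \o param c) ('d (i \o param c') (t y) \o 'd t y).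
  apply: (@near_is_diff _ _ _ ((i \o param c') \o t)).
    apply: (@filterS _ (nbhs y)) nearU => _ [z [dz dz'] <-].
    by rewrite /t /= !(pk, pk').
  exact: is_diff_comp (differentiableP d1) (differentiableP d3).
rewrite (diff_val (is_diff_def := H)) => v w /= /inj' h; apply: injt; apply: h.
by rewrite ty; exists x.
Qed.

End Charts.

(** * Smooth retracts are embedded manifolds *)

Lemma idempotent_factor (F : fieldType) k (P : 'M[F]_k) : P *m P = P ->
  exists r (C : 'M[F]_(k, r)) (D : 'M[F]_(r, k)), C *m D = P /\ D *m C = 1%:M.
Proof.
have [r [C [D [<- /row_fullP[L LC] /row_freeP[M DM]]]]] :
    exists r (C : 'M[F]_(k, r)) (D : 'M[F]_(r, k)),
      [/\ C *m D = P, row_full C & row_free D].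
  exists (\rank P), (col_base P), (row_base P).
  by rewrite mulmx_base col_base_full row_base_free.
move=> CDCD; exists r, C, D; split=> //.
have E1 : L *m (C *m D *m (C *m D)) *m M = D *m C.
  by rewrite !mulmxA LC mul1mx -!mulmxA DM mulmx1.
have E2 : L *m (C *m D) *m M = 1%:M by rewrite mulmxA LC mul1mx DM.
by rewrite -E1 CDCD E2.
Qed.

Section Retracts.
Context {R : realType}.
Implicit Types (V W E : normedModType R) (T : topologicalType).

Definition smooth_retract_at T E (i : T -> E) (x : T) : Prop :=
  exists (W : set E) (r : E -> E), [/\ open W, W (i x), smooth_on W r,
    forall z, W z -> exists y, r z = i y & forall y, W (i y) -> r (i y) = i y].

(** The differential [P] of the retraction at [x0 = i x] is idempotent, and its
range is the tangent space; a rank factorisation [P = C *m D] with [D *m C = 1]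
gives coordinates on it. The parametrisation is [y |-> r (y *m D + x0)],
corrected by the local inverse of its projection
[g y = (r (y *m D + x0) - x0) *m C], whose differential at [0] is the
identity. *)
Lemma smooth_retract_chart_rV T k (i : T -> 'rV[R]_k) x :
  embedding i -> smooth_retract_at i x ->
  exists2 c, embedded_atlas i c & dom c x.
Proof.
move=> emb [W [r [oW Wx sr rT rK]]]; have [ci inji ind] := emb.
set x0 := i x in Wx.
have half0 : 0 < 2^-1 :> R by rewrite invr_gt0.
have [d [d0 dW strict]] := C1_strict_differentiable oW Wx (sr 1%N) half0.
have dr : differentiable r x0 by exact: smooth_differentiable sr Wx.
have rx0 : r x0 = x0 by rewrite rK.
pose P := 'J r x0.
have PE v : 'd r x0 v = v *m P by rewrite /P /jacobian mul_rV_lin1.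
have PP : P *m P = P.
  have nr : \near x0, (r \o r) x0 = r x0.
    have rW : \near x0, W (r x0).
      have := smooth_continuous sr Wx; rewrite /prop_for /continuous_at rx0.
      by apply; exact: open_nbhs_nbhs.
    apply: (@filterS2 _ (nbhs x0) _ _ _ _ _ (open_nbhs_nbhs (conj oW Wx)) rW)
      => z Wz Wrz /=.
    by have [y ry] := rT _ Wz; rewrite ry in Wrz *; exact: rK.
  have dr' : is_diff (r x0) r ('d r x0) by rewrite rx0; exact: differentiableP.
  have H := near_is_diff nr (is_diff_comp (differentiableP dr) dr').
  apply/row_matrixP => j; rewrite !rowE mulmxA -!PE.
  have := diff_val (is_diff_def := H) => /(congr1 (@^~ (delta_mx 0 j))) /=.
  by move=> <-.
have [rk [C [D [CD DC]]]] := idempotent_factor PP.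
pose c (y : 'rV[R]_(rk)) := y *m D + x0.
have sc : smooth_on setT c.
  move=> l; apply: Ck_add; [exact: openT| |exact: Ck_cst].
  by apply: Ck_linear; [exact: findim_rV|move=> e u v;
    rewrite mulmxDl scalemxAl].
have cc y : {for y, continuous c} by exact: smooth_continuous sc _.
pose q (z : 'rV[R]_k) := (z - x0) *m C.
have sq : smooth_on setT q.
  move=> l; apply: Ck_mulmx; [exact: openT| |exact: Ck_cst].
  apply: Ck_add; [exact: openT| |exact: Ck_cst].
  by apply: Ck_linear; [exact: findim_rV|].
have cq : continuous q by move=> z; exact: smooth_continuous sq _.
pose B := ball x0 d.
have oB : open B by exact: ball_open.
have Bx : B x0 by exact: ballxx.
pose U1 := c @^-1` B.
have oU1 : open U1 by apply: open_comp => // y _; exact: cc.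
pose phi := r \o c.
have sphi1 : smooth_on U1 phi.
  apply: (smooth_comp (findim_rV _) oU1 oB) => //.
    exact: smooth_mono sc.
  exact: smooth_mono sr.
pose U := U1 `&` phi @^-1` B.
have oU : open U.
  by apply: (open_preimageI oU1 oB) => y U1y;
    exact: smooth_continuous sphi1 U1y.
have c0 : c 0 = x0 by rewrite /c mul0mx add0r.
have U0 : U 0 by split; rewrite /U1 /phi /= c0 // rx0.
have sphi : smooth_on U phi by apply: smooth_mono sphi1 => y [].
pose g := q \o phi.
have sg : smooth_on U g by apply: (smooth_comp (findim_rV _) oU openT).
have injg : injective ('d g 0).
  have dc : is_diff (0 : 'rV[R]_rk) c (fun y => y *m D).
    apply: is_diff_affine; first exact: findim_rV.
    by move=> e u v; rewrite mulmxDl scalemxAl.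
  have dr' : is_diff (c 0) r ('d r x0) by rewrite c0; exact: differentiableP.
  have dq z : is_diff z q (fun w => w *m C).
    rewrite (_ : q = fun w => w *m C + (- x0 *m C)); last first.
      by apply/funext => s; rewrite /q mulmxDl.
    apply: is_diff_affine; first exact: findim_rV.
    by move=> e u v; rewrite mulmxDl scalemxAl.
  have H := is_diff_comp (is_diff_comp dc dr') (dq _).
  rewrite (diff_val (is_diff_def := H)) => u v /=; rewrite !PE -!mulmxA -CD.
  by rewrite -!mulmxA DC mulmx1 DC !mulmx1.
have [V [h [[oV ogV] V0 VU hg sh]]] := inverse_function_rV oU U0 sg injg.
have phiT y : V y -> exists t, i t = phi y.
  by move=> /VU[U1y _]; have [|t it] := rT (c y); [exact: dW|exists t;
    exact: esym].
pose prm y := xget x [set t | i t = phi y].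
have iprm y : V y -> i (prm y) = phi y.
  by move=> /phiT[t it]; rewrite /prm; case: xgetP => [z _ //|/(_ t)].
pose crd t := h (q (i t)).
pose D0 := [set t | B (i t) /\ (g @` V) (q (i t))].
(* On [B] the retraction moves differences by almost [P], so a point of [T] in
   [B] is determined by its projection. *)
have Binj t z : B (i t) -> B z -> r z = z -> q (i t) = q z -> i t = z.
  move=> Bt Bz rz qtz; have := strict _ _ Bt Bz.
  rewrite rz rK ?PE; last exact: dW.
  have -> : (i t - z) *m P = 0.
    rewrite -CD mulmxA; suff -> : (i t - z) *m C = 0 by rewrite mul0mx.
    by move: qtz; rewrite /q !mulmxBl => /addIr ->; rewrite subrr.
  rewrite subr0 => H; apply/eqP; rewrite -subr_eq0 -normr_le0.
  by move: H; set s := `|_|; lra.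
have D0V t : D0 t -> V (crd t) /\ phi (crd t) = i t.
  move=> [Bt [y Vy gy]]; rewrite /crd -gy hg //; split => //.
  apply/esym/Binj => //; first by have [] := VU _ Vy.
  have [s is_] := phiT _ Vy; rewrite -is_; apply: rK.
  by rewrite is_; apply: dW; have [] := VU _ Vy.
have D0P y : V y -> D0 (prm y) /\ crd (prm y) = y.
  move=> Vy; rewrite /D0 /crd /= iprm //; split; last exact: hg.
  by split; [have [] := VU _ Vy|exists y].
pose ch : chart R T := Chart (rk) D0 crd prm.
have cdE : codom_of (c := ch) = V.
  apply/seteqP; split=> [_ [t /D0V[Vt _] <-] //|y Vy].
  by have [D0y cy] := D0P _ Vy; exists (prm y).
exists ch; last first.
  split => //=; exists 0 => //; rewrite /g /= /phi /= c0 rx0 //.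
have phiiprm y : V y -> \near y, phi y = (i \o prm) y.
  move=> Vy; apply: (@filterS _ (nbhs y)) (open_nbhs_nbhs (conj oV Vy)) => z.
  by move=> /iprm.
split; [split| |].
- rewrite (_ : dom ch = i @^-1` (B `&` q @^-1` (g @` V))) //.
  apply: open_comp => [y _|]; first exact: ci.
  by apply: openI => //; apply: open_comp => // z _; exact: cq.
- by rewrite cdE.
- by move=> t /D0V[Vt pt] /=; apply: inji; rewrite iprm.
- move=> t [_ gt]; apply: (@continuous_comp _ _ _ (q \o i) h).
    by apply: continuous_comp; [exact: ci|exact: cq].
  exact: smooth_continuous sh gt.
- rewrite cdE => y Vy; apply: (embedding_continuous emb).
  have cphi : {for y, continuous phi} by apply: smooth_continuous sphi (VU _
    Vy).
  rewrite /prop_for /continuous_at /= iprm //.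
  apply: cvg_trans cphi; exact: near_eq_cvg (phiiprm _ Vy).
- rewrite cdE; apply: (smooth_eq (f := phi)) => //.
    by move=> y Vy; rewrite -iprm.
  exact: smooth_mono sphi.
- rewrite cdE => y Vy.
  have dphi : differentiable phi y by exact: smooth_differentiable sphi (VU _
    Vy).
  have dhq : differentiable (h \o q) (phi y).
    apply: differentiable_comp; first exact: smooth_differentiable sq _.
    by apply: smooth_differentiable sh _; exists y.
  have H : is_diff y (i \o prm) ('d phi y).
    exact: near_is_diff (phiiprm _ Vy) (differentiableP dphi).
  rewrite (diff_val (is_diff_def := H)).
  apply: near_left_inverse_inj dphi dhq _.
  apply: (@filterS _ (nbhs y)) (open_nbhs_nbhs (conj oV Vy)) => z Vz.
  exact: hg.
Qed.

End Retracts.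

Section EmbeddedStructure.
Context {R : realType}.
Implicit Types (V W E : normedModType R) (T : topologicalType).

Lemma smooth_retract_chart T E (i : T -> E) x : findim E ->
  embedding i -> smooth_retract_at i x ->
  exists2 c, embedded_atlas i c & dom c x.
Proof.
move=> fE emb [W [r [oW Wx sr rT rK]]].
have [k [u [v [cu cv uK vK]]]] := fE.
have lu := linearP u; have lv := linearP v.
have oW' : open (v @^-1` W) by apply: open_comp => // y _; exact: cv.
have sur : smooth_on W (u \o r).
  by apply: (smooth_comp fE oW openT) => //; exact: (smooth_linear _ fE lu).
have [|c [chc sc injc] dx] := smooth_retract_chart_rV (x :=
  x) (embedding_comp cu cv uK emb).
  exists (v @^-1` W), ((u \o r) \o v); split => //.
  - by rewrite /= uK.
  - apply: (smooth_comp fE oW' oW (f := v)) => //.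
    exact: (smooth_linear _ (findim_rV k) lv).
  - by move=> z /rT[y ry]; exists y; rewrite /= ry.
  - by move=> y /=; rewrite uK => /rK ->.
have vuE : i \o param c = v \o (u \o i \o param c).
  by apply/funext => y /=; rewrite uK.
have [od ocd pk cc cp] := chc.
exists c => //; split => //.
  rewrite vuE; apply: (smooth_comp (findim_rV k) ocd openT) => //.
  exact: (smooth_linear _ (findim_rV k) lv).
move=> y Vy; rewrite vuE.
have H := is_diff_comp (differentiableP (smooth_differentiable sc Vy))
  (findim_is_diff_linear ((u \o i \o param c) y) (findim_rV k) lv).
rewrite (diff_val (is_diff_def := H)) => a b /= /(can_inj vK).
exact: injc.
Qed.

Theorem embedded_smooth_structure T E (i : T -> E) : findim E ->
  embedding i -> (forall x, smooth_retract_at i x) ->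
  smooth_structure (embedded_atlas i).
Proof.
move=> fE emb ret.
have cov x : exists2 c, embedded_atlas i c & dom c x.
  exact: smooth_retract_chart.
split => //.
- split; first exact: embedding_hausdorff emb (@norm_hausdorff _ _).
  have [k [u [v [cu cv uK vK]]]] := fE.
  exact: embedding_second_countable (embedding_comp cu cv uK emb).
- by move=> c [].
- by move=> c c'; exact: embedded_compatible.
- by apply: generated_sub_embedded.
Qed.

Lemma embedded_smooth_map (S T : topologicalType) V E (i : S -> V) (j : T ->
  E) (f : S -> T) :
  findim E -> embedding j -> continuous f ->
  (forall c, embedded_atlas i c -> smooth_on (codom_of (c := c)) (j \o f \o
    param c)) ->
  smooth_map (embedded_atlas i) (embedded_atlas j) f.
Proof.
move=> fE emb cf sf; split=> // c c' ac ac'.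
have [chc _ _] := ac; have [od ocd pk cc cp] := chc.
have [[od' _ _ _ _] _ _] := ac'.
apply: (embedded_coord_smooth (f := f \o param c) fE ac').
- apply: chart_preimage_open => //; apply: open_comp => // x _; exact: cf.
- move=> _ [x [dx dx'] <-]; apply: continuous_comp; last exact: cf.
  by apply: cp; exists x.
- by move=> _ [x [dx dx'] <-] /=; rewrite pk.
- by apply: smooth_mono (sf _ ac) => _ [x [dx dx'] <-]; exists x.
Qed.

(** Both structures are read off from the same ambient space, where [f] and [g]
become inclusions. *)
Theorem embedded_diffeomorphism (S T : topologicalType) E (i : S ->
  E) (j : T -> E) (f : S -> T)
    (g : T -> S) : findim E -> embedding i -> embedding j ->
  (forall x, j (f x) = i x) -> cancel f g -> cancel g f ->
  diffeomorphism (embedded_atlas i) (embedded_atlas j) f.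
Proof.
move=> fE ei ej jf fK gK.
have jfE : j \o f = i by apply/funext.
have igE : i \o g = j by apply/funext => y /=; rewrite -jf gK.
split.
  apply: embedded_smooth_map => // [x|c [_ sc _]]; last by rewrite jfE.
  by apply: (embedding_continuous ej); rewrite jfE; case: ei => + _ _; apply.
exists g; split => //.
apply: embedded_smooth_map => // [x|c [_ sc _]]; last by rewrite igE.
by apply: (embedding_continuous ei); rewrite igE; case: ej => + _ _; apply.
Qed.

End EmbeddedStructure.

(** * Quotients with smooth local sections *)

Section Quotients.
Context {R : realType}.
Variables (S T : topologicalType) (E F : normedModType R).
Variables (i : S -> E) (j : T -> F) (p : S -> T) (phi : E -> F).
Hypotheses (fE : findim E) (fF : findim F).
Hypotheses (ei : embedding i) (ri : forall s, smooth_retract_at i s).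
Hypotheses (cp : continuous p) (ps : forall t, exists s, p s = t).
Hypotheses (cj : continuous j) (jI : injective j).
Hypotheses (sphi : smooth_on setT phi) (jp : forall s, j (p s) = phi (i s)).

(** Local sections of [p], written in the ambient space of [T]; the last clause
says that [p \o sigma] inverts [j] on the image of [j]. *)
Hypothesis sections : forall s, exists (W : set F) (sigma : F -> S),
  [/\ open W, W (j (p s)), smooth_on W (i \o sigma), sigma (j (p s)) = s &
      forall t, W (j t) -> j (p (sigma (j t))) = j t].

Let section_continuous W (sigma : F -> S) w :
  smooth_on W (i \o sigma) -> W w -> {for w, continuous sigma}.
Proof.
by move=> ss Ww; apply: (embedding_continuous ei);
  exact: smooth_continuous ss Ww.
Qed.

Lemma quotient_embedding : embedding j.
Proof.
split=> // x U xU; have [s psx] := ps x.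
have [W [sigma [oW Wx ss ssx sj]]] := sections s; rewrite psx in Wx ssx.
have cps : {for j x, continuous (p \o sigma)}.
  by apply: continuous_comp; [exact: section_continuous ss Wx|exact: cp].
have nU : \forall z \near j x, U ((p \o sigma) z).
  by apply: cps; rewrite /= ssx psx.
apply: (@filterS2 _ (nbhs (j x)) _ _ _ _ _ (open_nbhs_nbhs (conj oW Wx)) nU).
move=> z Wz Uz y jy; suff -> : y = p (sigma z) by [].
by apply: jI; rewrite -jy sj // jy.
Qed.

(** The retraction lifts a point by [sigma] and pushes it down again. *)
Lemma quotient_retract t : smooth_retract_at j t.
Proof.
have [s pst] := ps t; have [W [sigma [oW Wx ss ssx sj]]] := sections s.
rewrite pst in Wx ssx.
exists W, (phi \o (i \o sigma)); split=> //.
- by apply: (smooth_comp fE oW openT).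
- by move=> z Wz; exists (p (sigma z)); rewrite /= jp.
- by move=> y Wy; rewrite /= -jp; exact: sj.
Qed.

(** Read in charts, a local section through [x] is a right inverse of [p] whose
value at [p x] is [x]; so the differential of [p] at [x] is onto. *)
Lemma quotient_submersion : submersion (embedded_atlas i) (embedded_atlas j) p.
Proof.
have sm : smooth_map (embedded_atlas i) (embedded_atlas j) p.
  apply: embedded_smooth_map => //; first exact: quotient_embedding.
  move=> c [[od ocd pk cc ccp] sc _].
  have -> : j \o p \o param c = phi \o (i \o param c).
    by apply/funext => y /=; rewrite jp.
  by apply: (smooth_comp fE ocd openT).
split => // x c c' ac ac' dx dx'.
have [[od ocd pk cc ccp] sc _] := ac; have [[od' ocd' pk' cc' cp'] sc' _] :=
  ac'.
have [W [sigma [oW Wx ss ssx sj]]] := sections x.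
pose z0 := coord c' (p x).
have cdz0 : codom_of (c := c') z0 by exists (p x).
have jpz0 : j (param c' z0) = j (p x) by rewrite /z0 pk'.
pose U1 := codom_of (c := c') `&` (j \o param c') @^-1` W.
have oU1 : open U1.
  by apply: (open_preimageI ocd' oW) => z cz; exact: smooth_continuous sc' cz.
have s1 : smooth_on U1 (i \o (sigma \o (j \o param c'))).
  apply: (smooth_comp fF oU1 oW (f := j \o param c') (g := i \o sigma)) => //.
    by move=> z [].
  by apply: smooth_mono sc' => z [].
have c1 z : U1 z -> {for z, continuous (sigma \o (j \o param c'))}.
  move=> Uz; apply: (embedding_continuous ei); exact: smooth_continuous s1 Uz.
pose U2 := U1 `&` (sigma \o (j \o param c')) @^-1` dom c.
have oU2 : open U2 by exact: open_preimageI.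
have U2z0 : U2 z0.
  by split; [split => //; rewrite /= jpz0|rewrite /= jpz0 ssx].
pose tau := coord c \o (sigma \o (j \o param c')).
have stau : smooth_on U2 tau.
  apply: (embedded_coord_smooth fE ac) => //.
  - by move=> z [Uz _]; exact: c1.
  - by move=> z [].
  - by apply: smooth_mono s1 => z [].
have tauz0 : tau z0 = coord c x by rewrite /tau /= jpz0 ssx.
pose q := coord c' \o p \o param c.
have dq : differentiable q (tau z0).
  rewrite tauz0; apply: smooth_differentiable (sm.2 _ _ ac ac') _.
  by exists x.
have dtau := smooth_differentiable stau U2z0.
have nq : \near z0, (q \o tau) z0 = z0.
  apply: (@filterS _ (nbhs z0)) (open_nbhs_nbhs (conj oU2 U2z0)).
  move=> _ [[[t dt <-]]]; rewrite /q /tau /= pk' // => Wt dst.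
  by rewrite pk //; congr (coord c' _); apply: jI; exact: sj.
have H := is_diff_comp (differentiableP dtau) (differentiableP dq).
have H1 := near_is_diff nq H; rewrite -tauz0.
apply/seteqP; split=> // w _; exists ('d tau z0 w) => //.
have := diff_val (is_diff_def := H1).
by rewrite (diff_val (is_diff_def := is_diff_id z0)) => /(congr1 (@^~ w)).
Qed.

(** Let [c'] be a chart of a structure for which [p] is a submersion. A local
right inverse of [p], read in [c'], writes the parametrisation of [c'] as a
smooth map into the ambient space; a local section [sigma] extends the
coordinates of [c'] to a smooth function on the ambient space, so the
parametrisation is an immersion. *)
Lemma submersion_atlas_sub (A : set (chart R T)) :
  smooth_structure A -> submersion (embedded_atlas i) A p ->
  A `<=` embedded_atlas j.
Proof.
move=> [_ Ach _ _ _] [[_ smA] subA] c' Ac'.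
have chc' := Ach _ Ac'; have [od' ocd' pk' cc' cp'] := chc'.
have setup t : dom c' t -> exists s c, [/\ p s = t, embedded_atlas i c &
  dom c s].
  move=> dt; have [s pst] := ps t.
  by have [c ac ds] := smooth_retract_chart fE ei (ri s); exists s, c.
have sjc : smooth_on (codom_of (c := c')) (j \o param c').
  apply: smooth_local => _ [t dt <-].
  have [s [c [pst ac ds]]] := setup _ dt.
  have [chc sc _] := ac; have [od ocd pk cc ccp] := chc.
  pose U := coord c @` (dom c `&` p @^-1` dom c').
  have oU : open U.
    by apply: chart_preimage_open => //; apply: open_comp => // x _; exact: cp.
  pose q := coord c' \o p \o param c.
  have sq : smooth_on U q by exact: smA.
  have Us : U (coord c s) by exists s => //; split => //=; rewrite pst.
  have surj : range ('d q (coord c s)) = setT.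
    by apply: subA => //; rewrite pst.
  have [Z [tau [oO Oq stau tauK]]] := submersion_right_inverse oU Us sq surj.
  exists Z; first by move: Oq; rewrite /q /= pk // pst.
  apply: (smooth_eq (f := phi \o ((i \o param c) \o tau))) => //.
    move=> z /tauK [[s' [ds' dps'] ts']] /=; rewrite /q /= -ts' pk // => <-.
    by rewrite pk' // jp.
  apply: (smooth_comp fE oO openT) => //.
  apply: (smooth_comp (findim_rV _) oO ocd) => // z /tauK[[s' [ds' _] <-] _].
  by exists s'.
split=> // _ [t dt <-].
have [s [c [pst ac ds]]] := setup _ dt.
have [chc sc _] := ac; have [od ocd pk cc ccp] := chc.
have [W [sigma [oW Wx ss ssx sj]]] := sections s; rewrite pst in Wx ssx.
have csig w : W w -> {for w, continuous sigma}.
  exact: section_continuous.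
pose W1 := W `&` sigma @^-1` (dom c `&` p @^-1` dom c').
have oU : open (dom c `&` p @^-1` dom c').
  by apply: openI => //; apply: open_comp => // x _; exact: cp.
have oW1 : open W1 by exact: open_preimageI.
pose U := coord c @` (dom c `&` p @^-1` dom c').
have oU' : open U by apply: chart_preimage_open => //; apply: open_comp =>
  // x _; exact: cp.
have W1t : W1 (j t) by split=> //; rewrite /= ssx pst.
pose l := (coord c' \o p \o param c) \o (coord c \o sigma).
have sl : smooth_on W1 l.
  apply: (smooth_comp (findim_rV _) oW1 oU').
  - by move=> w [_ [d1 d2]]; exists (sigma w).
  - apply: (embedded_coord_smooth fE ac) => //.
    + by move=> w [Ww _]; exact: csig.
    + by move=> w [_ []].
    + by apply: smooth_mono ss => w [].
  - exact: smA.
have ct : codom_of (c := c') (coord c' t) by exists t.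
apply: (near_left_inverse_inj (g := l)).
- exact: smooth_differentiable sjc ct.
- by apply: smooth_differentiable sl _; rewrite /= pk'.
- have cjc : {for coord c' t, continuous (j \o param c')}.
    exact: smooth_continuous sjc ct.
  have n1 : \forall z \near coord c' t, W1 ((j \o param c') z).
    by apply: cjc; rewrite /= pk' //; exact: open_nbhs_nbhs.
  apply: (@filterS2 _ (nbhs (coord c' t)) _ _ _ _ _
    (open_nbhs_nbhs (conj ocd' ct)) n1).
  move=> _ [t' dt' <-]; rewrite /l /= pk' // => -[Wt' [d1 d2]].
  by rewrite pk //; congr (coord c' _); apply: jI; exact: sj.
Qed.

(** Any structure for which [p] is a submersion consists of embedded charts;
both structures being maximal, they agree. *)
Theorem quotient_structure_unique (A : set (chart R T)) :
  smooth_structure A /\ submersion (embedded_atlas i) A p <->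
  A = embedded_atlas j.
Proof.
split=> [[sA subA]|->]; last first.
  split; last exact: quotient_submersion.
  apply: embedded_smooth_structure => //; first exact: quotient_embedding.
  exact: quotient_retract.
have Aj := submersion_atlas_sub sA subA.
apply/seteqP; split=> // c ac; case: sA => _ _ _ _; apply; split.
  by case: ac.
by move=> c' /Aj ac'; apply: (embedded_compatible fF ac).
Qed.

End Quotients.

(** * Coproducts of embedded manifolds *)

Section Coproduct.
Context {R : realType} {I : choiceType} {X : I -> topologicalType}.
Variables (E : normedModType R) (j : forall i, X i -> E).
Hypothesis fE : findim E.

Definition coproduct_map (x : {i & X i}) : E := j (tagged x).

Hypothesis emb : embedding coproduct_map.

Lemma untag_existT (A : Type) (a : A) i (f : X i -> A) (x : X i) :
  untag a f (existT X i x) = f x.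
Proof. by rewrite (@untagE _ _ _ a i f (existT X i x) erefl). Qed.

Lemma sigT_chart_embedded i (c : chart R (X i)) :
  embedded_atlas (@j i) c -> embedded_atlas coproduct_map (sigT_chart (X :=
    X) c).
Proof.
move=> [[od ocd pk cc cp] sc inj].
have cdE : codom_of (c := sigT_chart (X := X) c) = codom_of (c := c).
  apply/seteqP; split=> [_ [_ [x dx <-] <-]|_ [x dx <-]] /=.
    by rewrite untag_existT; exists x.
  by exists (existT X i x); [exists x|rewrite /= untag_existT].
split; [split| |].
- exact: existT_open_map.
- by rewrite cdE.
- by move=> _ [x dx <-] /=; rewrite untag_existT pk.
- move=> _ [x dx <-] U /=; rewrite untag_existT => /(cc _ dx) H.
  apply: (@filterS _ (nbhs x)) H => y /=.
  by rewrite untag_existT.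
- rewrite cdE => y cy /=.
  apply: (@continuous_comp _ _ _ (param c) (existT X i)); first exact: cp.
  exact: existT_continuous.
- by rewrite cdE.
- by rewrite cdE.
Qed.

Theorem coproduct_embedded_atlas :
  (forall i x, exists2 c, embedded_atlas (@j i) c & dom c x) ->
  coproduct_atlas (fun i => embedded_atlas (@j i)) =
    embedded_atlas coproduct_map.
Proof.
move=> cov.
have sub : \bigcup_i (@sigT_chart R I X i @` embedded_atlas (@j i)) `<=`
    embedded_atlas coproduct_map.
  by move=> _ [i _ [c ac <-]]; exact: sigT_chart_embedded.
apply/seteqP; split.
  apply: generated_sub_embedded => // -[i x]; have [c ac dx] := cov i x.
  exists (sigT_chart (X := X) c); last by exists x.
  by exists i => //; exists c.
move=> c ac; split; first by case: ac.
by move=> c' /sub ac'; exact: (embedded_compatible fE ac).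
Qed.

End Coproduct.

(** * Polar factors *)

Section PolarDecomposition.
Context {R : realType}.

Lemma unitmx_open n : open [set X : 'M[R]_n | X \in unitmx].
Proof.
rewrite openE => X /= ; rewrite unitmxE unitfE => X0.
have cdet : {for X, continuous (fun Y : 'M[R]_n => \det Y)}.
  have CX : Ck 0 setT (fun Y : 'M[R]_n => Y) by move=> Y _; exact: cvg_id.
  exact: (Ck_continuous (Ck_det openT CX) I).
have H := cvgr_neq0 _ cdet X0.
by apply: (@filterS _ (nbhs X)) (H _) => Y /=; rewrite unitmxE unitfE.
Qed.

(** Squaring is a local diffeomorphism at the identity; its local inverse
commutes with transposition because it is unique. *)
Lemma smooth_inverse_sqrtmx n : exists (Om : set 'M[R]_n) (isq : 'M[R]_n ->
  'M[R]_n),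
  [/\ open Om, Om 1%:M, smooth_on Om isq, isq 1%:M = 1%:M &
    forall S, Om S -> S^T = S -> (isq S)^T = isq S /\ isq S *m S *m isq S =
      1%:M].
Proof.
pose f (T : 'M[R]_n) := T *m T.
have fM : findim 'M[R]_n by exact: findim_mx.
pose U := [set X : 'M[R]_n | X \in unitmx].
have oU : open U by exact: unitmx_open.
have idC k (A : set 'M[R]_n) : Ck k A id by apply: Ck_linear.
have sf : smooth_on U f by move=> k; apply: Ck_mulmx.
have U1 : U 1%:M by exact: unitmx1.
have injf : injective ('d f (1%:M : 'M[R]_n)).
  have id1 : is_diff (1%:M : 'M[R]_n) id id by exact: is_diff_id.
  have H := is_diff_mulmx id1 id1.
  rewrite (diff_val (is_diff_def := H)) => x y /=.
  rewrite !mul1mx !mulmx1 => /matrixP xy; apply/matrixP => i j.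
  by have := xy i j; rewrite !mxE; lra.
have [V [h [[oV ofV] V1 VU hf sh]]] := inverse_function fM oU U1 sf injf.
have h1 : h 1%:M = 1%:M by rewrite -[RHS]hf // /f mulmx1.
have fV1 : (f @` V) 1%:M by exists 1%:M => //; rewrite /f mulmx1.
have str : smooth_on (f @` V) (fun S => (h S)^T).
  by move=> k; apply: Ck_trmx => //; exact: sh.
pose Om := (f @` V) `&` (fun S => (h S)^T) @^-1` V.
have oOm : open Om.
  by apply: (open_preimageI ofV oV) => S fS; exact: smooth_continuous str fS.
exists Om, (fun S => invmx (h S)); split => //.
- by split => //=; rewrite h1 trmx1.
- move=> k; apply: Ck_invmx => //.
    by move=> S [[T VT <-] _]; rewrite hf //; exact: VU.
  by apply: Ck_mono (sh k) => S [].
- by rewrite h1 invmx1.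
- move=> S [[T VT fT] /= VhT] Sy.
  have hS : h S = T by rewrite -fT hf.
  rewrite hS in VhT *; have Tu : T \in unitmx by exact: VU.
  have TT : T^T = T.
    rewrite -[LHS]hf // -[RHS]hf //; congr (h _).
    by rewrite /f -trmx_mul -/(f T) fT.
  split; first by rewrite trmx_inv TT.
  by rewrite -fT /f mulmxA mulVmx // mul1mx mulmxV.
Qed.

Definition orthonormal_cols m n (Y : 'M[R]_(m, n)) := Y^T *m Y = 1%:M.

Lemma O_orthonormal n (X : 'M[R]_n) : O R n X <-> orthonormal_cols X.
Proof. by split => /mulmx1C. Qed.

Lemma smooth_gram (V : normedModType R) k (U : set V) m n (f : V -> 'M[R]_(m,
  n)) : open U ->
  Ck k U f -> Ck k U (fun x => (f x)^T *m f x).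
Proof. by move=> oU cf; apply: Ck_mulmx => //; exact: Ck_trmx. Qed.

(** The polar factor of [Y] is [Y *m (Y^T *m Y)^(-1/2)]. Its expression through
[isq] shows that its columns stay in the column space of [Y]. The last clause
computes the tangent space of the orthonormal frames: the Gram matrix is
stationary in the direction [Z], so only the factor [Y] varies. *)
Lemma smooth_polar m n : exists (W : set 'M[R]_(m, n))
    (pol : 'M[R]_(m, n) -> 'M[R]_(m, n)) (isq : 'M[R]_n -> 'M[R]_n),
  [/\ open W, forall Y, orthonormal_cols Y -> W Y /\ pol Y = Y, smooth_on W pol,
    forall Y, W Y -> orthonormal_cols (pol Y) &
    (forall Y, pol Y = Y *m isq (Y^T *m Y)) /\
    forall Y, orthonormal_cols Y -> forall Z, Z^T *m Y + Y^T *m Z = 0 ->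
      'd pol Y Z = Z].
Proof.
have [Om [isq [oOm Om1 sisq isq1 isqP]]] := smooth_inverse_sqrtmx n.
pose gram (Y : 'M[R]_(m, n)) := Y^T *m Y.
have idC k (A : set 'M[R]_(m, n)) : Ck k A id.
  by apply: Ck_linear => //; exact: findim_mx.
have sgram : smooth_on setT gram by move=> k; apply: smooth_gram;
  [exact: openT|].
pose W := gram @^-1` Om.
have oW : open W.
  by apply: open_comp => // Y _; exact: smooth_continuous sgram _.
pose pol (Y : 'M[R]_(m, n)) := Y *m isq (gram Y).
have sig : smooth_on W (isq \o gram).
  apply: (smooth_comp (findim_mx _ _) oW oOm) => // k.
  by apply: Ck_mono (sgram k).
exists W, pol, isq; split => //.
- by move=> Y oY; rewrite /W /pol /gram /= oY isq1 mulmx1.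
- by move=> k; apply: Ck_mulmx => //; exact: sig.
- move=> Y WY; have [] := isqP (gram Y) WY; first by rewrite trmx_mul trmxK.
  move=> isqT H; rewrite /orthonormal_cols /pol trmx_mul isqT -[RHS]H.
  by rewrite !mulmxA.
split=> // Y oY Z ZY.
have WY : W Y by rewrite /W /= /gram oY.
have idY : is_diff Y id id by exact: is_diff_id.
have trY : is_diff Y (@trmx R m n) (@trmx R m n).
  apply: findim_is_diff_linear; first exact: findim_mx.
  by move=> a A B; rewrite linearP.
have dg := is_diff_mulmx trY idY.
have dq : is_diff (gram Y) isq ('d isq (gram Y)).
  by apply: differentiableP; exact: smooth_differentiable sisq WY.
have H := is_diff_mulmx idY (is_diff_comp dg dq).
rewrite (diff_val (is_diff_def := H)) /=.
by rewrite addrC [Y^T *m Z + _]addrC ZY linear0 mulmx0 addr0 oY isq1 mulmx1.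
Qed.

(** Outside [W] the retraction takes the arbitrary value [1], so that it maps
all matrices into the orthogonal group. *)
Lemma smooth_orthogonal_retract n : exists (W : set 'M[R]_n)
    (pol : 'M[R]_n -> 'M[R]_n),
  [/\ open W, O R n `<=` W, smooth_on W pol, forall X, O R n (pol X) &
    forall X, O R n X -> pol X = X /\
      forall Z, Z^T *m X + X^T *m Z = 0 -> 'd pol X Z = Z].
Proof.
have [W [pol [isq [oW Wo sp Wp [polE dpol]]]]] := smooth_polar n n.
pose pol' X := if `[< W X >] then pol X else 1%:M.
have polE' X : W X -> pol X = pol' X by move=> WX; rewrite /pol' asboolT.
exists W, pol'; split => //.
- by move=> X /O_orthonormal/Wo[].
- exact: smooth_eq sp.
- move=> X; rewrite /pol'; case: asboolP => WX.
    exact/O_orthonormal/Wp.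
  by apply/O_orthonormal; rewrite /orthonormal_cols trmx1 mulmx1.
- move=> X /O_orthonormal oX; have [WX pX] := Wo _ oX.
  rewrite -polE' //; split=> // Z /(dpol _ oX) dZ; rewrite -[RHS]dZ.
  have dX : differentiable pol X by exact: smooth_differentiable sp WX.
  have nX : \near X, pol X = pol' X.
    by apply: (@filterS _ (nbhs X)) (open_nbhs_nbhs (conj oW WX)).
  have H := near_is_diff nX (differentiableP dX).
  exact: (congr1 (@^~ Z) (diff_val (is_diff_def := H))).
Qed.

End PolarDecomposition.

(** * Block matrices depending smoothly on a parameter *)

Section BlockCalculus.
Context {R : realType}.
Implicit Types V : normedModType R.

Lemma Ck_mx_reindex V k (U : set V) m n m' n' (f : V -> 'M[R]_(m, n))
    (g : V -> 'M[R]_(m', n')) : open U ->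
  (forall a b, exists a' b', forall x, g x a b = f x a' b') ->
  Ck k U f -> Ck k U g.
Proof.
move=> oU gf cf; apply: Ck_mx => // a b; have [a' [b' E]] := gf a b.
rewrite (_ : (fun _ => _) = fun x => f x a' b'); first exact: Ck_entry.
exact/funext.
Qed.

Variables (p q : nat) (p_ : 'I_p -> nat) (q_ : 'I_q -> nat).

Lemma Ck_mxblock V k (U : set V) (B : forall i j, V -> 'M[R]_(p_ i, q_ j)) :
  open U -> (forall i j, Ck k U (B i j)) ->
  Ck k U (fun x => \mxblock_(i, j) B i j x).
Proof.
move=> oU cB; apply: Ck_mx => // a b.
rewrite (_ : (fun _ => _) = fun x =>
  B (tagnat.sig1 a) (tagnat.sig1 b) x (tagnat.sig2 a) (tagnat.sig2 b)).
  exact: Ck_entry.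
by apply/funext => x; rewrite mxE.
Qed.

Lemma Ck_submxblock V k (U : set V) (f : V -> 'M[R]_(\sum_i p_ i,
  \sum_j q_ j)) i j :
  open U -> Ck k U f -> Ck k U (fun x => submxblock (f x) i j).
Proof.
move=> oU; apply: Ck_mx_reindex => // a b.
by exists (tagnat.Rank i a), (tagnat.Rank j b) => x; rewrite mxE.
Qed.

Lemma Ck_submxrow V k (U : set V) m (f : V -> 'M[R]_(m, \sum_j q_ j)) j :
  open U -> Ck k U f -> Ck k U (fun x => submxrow (f x) j).
Proof.
move=> oU; apply: Ck_mx_reindex => // a b.
by exists a, (tagnat.Rank j b) => x; rewrite mxE.
Qed.

Lemma Ck_mxrow V k (U : set V) m (B : forall j, V -> 'M[R]_(m, q_ j)) :
  open U -> (forall j, Ck k U (B j)) -> Ck k U (fun x => \mxrow_j B j x).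
Proof.
move=> oU cB; apply: Ck_mx => // a b.
rewrite (_ : (fun _ => _) = fun x => B (tagnat.sig1 b) x a (tagnat.sig2 b)).
  exact: Ck_entry.
by apply/funext => x; rewrite mxE.
Qed.

Lemma Ck_castmx V k (U : set V) m n m' n' (e : (m = m') * (n = n'))
    (f : V -> 'M[R]_(m, n)) :
  open U -> Ck k U f -> Ck k U (fun x => castmx e (f x)).
Proof.
move=> oU; apply: Ck_mx_reindex => // a b.
by exists (cast_ord (esym e.1) a), (cast_ord (esym e.2) b) => x;
  rewrite castmxE.
Qed.

Lemma Ck_mxdiag V k (U : set V) (B : forall i, V -> 'M[R]_(p_ i)) :
  open U -> (forall i, Ck k U (B i)) -> Ck k U (fun x => \mxdiag_i B i x).
Proof.
move=> oU cB; apply: (@Ck_mx _ _ _ _ _ _ _ oU) => a b.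
have [E|E] := boolP (tagnat.sig1 a == tagnat.sig1 b); last first.
  rewrite (_ : (fun _ => _) = fun=> 0); first exact: Ck_cst.
  by apply/funext => x; rewrite !mxE (negbTE E) mxE.
rewrite (_ : (fun _ => _) = fun x =>
  (conform_mx (0 : 'M[R]_(p_ (tagnat.sig1 a),
    p_ (tagnat.sig1 b))) (B (tagnat.sig1 a) x)) (tagnat.sig2 a) (tagnat.sig2
      b)).
  move: (tagnat.sig2 b); rewrite -(eqP E) => b2.
  rewrite (_ : (fun _ => _) = fun x => B (tagnat.sig1 a) x (tagnat.sig2 a) b2).
    exact: Ck_entry.
  by apply/funext => x; rewrite conform_mx_id.
by apply/funext => x; rewrite !mxE E.
Qed.

End BlockCalculus.

(** * Orthogonal groups *)

Section OrthogonalGroups.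
Context {R : realType}.

Definition orth_polar_dom n : set 'M[R]_n :=
  sval (cid (smooth_orthogonal_retract (R := R) n)).
Definition orth_polar n : 'M[R]_n -> 'M[R]_n :=
  sval (cid (svalP (cid (smooth_orthogonal_retract (R := R) n)))).

Lemma orth_polarP n : [/\ open (orth_polar_dom (n := n)),
  O R n `<=` orth_polar_dom (n := n),
  smooth_on (orth_polar_dom (n := n)) (orth_polar (n := n)), forall X,
    O R n (orth_polar X) &
    forall X, O R n X -> orth_polar X = X /\
      forall Z, Z^T *m X + X^T *m Z = 0 -> 'd (orth_polar (n := n)) X Z = Z].
Proof. exact: svalP (cid (svalP (cid (smooth_orthogonal_retract (R :=
  R) n)))). Qed.

Lemma O_embedding n : embedding (fun X : O R n => \val X).
Proof. exact: embedding_set_val. Qed.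

Lemma O_retract n (X : O R n) : smooth_retract_at (fun X : O R n => \val X) X.
Proof.
have [oW OW spol Opol polO] := orth_polarP n.
exists (orth_polar_dom (n := n)), (orth_polar (n := n)); split => //.
- exact/OW/set_valP.
- by move=> Z _; exists (exist _ (orth_polar Z) (mem_set (Opol Z))).
- by move=> Y _; have [] := polO _ (set_valP Y).
Qed.

Lemma continuous_mxdiag (p : nat) (p_ : 'I_p -> nat) :
  continuous (fun f : prod_topology (fun i => 'M[R]_(p_ i)) => \mxdiag_i f i).
Proof.
move=> f; apply: continuous_mx => a b.
have cf i : {for f, continuous (fun f : prod_topology (fun i =>
  'M[R]_(p_ i)) => f i)}.
  exact: proj_continuous.
have [E|E] := boolP (tagnat.sig1 a == tagnat.sig1 b); last first.
  rewrite (_ : (fun _ => _) = fun=> 0); first exact: cst_continuous.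
  by apply/funext => x; rewrite !mxE (negbTE E) mxE.
rewrite (_ : (fun _ => _) = fun x : prod_topology (fun i => 'M[R]_(p_ i)) =>
   (conform_mx (0 : 'M[R]_(p_ (tagnat.sig1 a),
     p_ (tagnat.sig1 b))) (x (tagnat.sig1 a))) (tagnat.sig2 a) (tagnat.sig2 b)).
  move: (tagnat.sig2 b); rewrite -(eqP E) => b2.
  rewrite (_ : (fun _ => _) = (fun y : 'M[R]_(p_ (tagnat.sig1 a)) =>
    y (tagnat.sig2 a) b2) \o
      (fun x : prod_topology (fun i => 'M[R]_(p_ i)) => x (tagnat.sig1 a))).
    apply: (continuous_comp (cf (tagnat.sig1 a))); exact: coord_continuous.
  by apply/funext => x /=; rewrite conform_mx_id.
by apply/funext => x; rewrite !mxE E.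
Qed.

Variables (s t : nat) (m : 'I_s -> nat) (n : 'I_t -> nat).
Local Notation G := (Oprod R m * Oprod R n)%type.
Local Notation EG := ('M[R]_(\sum_i m i) * 'M[R]_(\sum_j n j))%type.

(** The embedding that defines [G_atlas]. *)
Definition diag_embed (p : G) : EG := (\mxdiag_i \val p.1 i,
  \mxdiag_j \val p.2 j).

Lemma findim_EG : findim EG.
Proof. by apply: findim_prod; exact: findim_mx. Qed.

Lemma diag_embed_embedding : embedding diag_embed.
Proof.
pose P1 := prod_topology (fun i => 'M[R]_(m i)).
pose P2 := prod_topology (fun j => 'M[R]_(n j)).
pose k (p : G) : P1 * P2 := (\val p.1, \val p.2).
pose rho (z : EG) : P1 * P2 :=
  ((fun i => submxblock z.1 i i), (fun j => submxblock z.2 j j)).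
have ek : embedding k by apply: embedding_pair; exact: embedding_set_val.
have idC l (A : set EG) : Ck l A id by apply: Ck_linear; [exact: findim_EG|].
apply: (@embedding_left_inverse _ _ _ diag_embed k rho) => //.
- have [ck _ _] := ek.
  have cd := continuous_pair (@continuous_mxdiag _ m) (@continuous_mxdiag _ n).
  by move=> p; exact: (@continuous_comp _ _ _ k _ p (ck p) (cd (k p))).
- move=> p; have c1 : {for diag_embed p, continuous (fun z => (rho z).1)}.
    apply: continuous_prod_topology => i.
    have C : Ck 0 setT (fun z : EG => submxblock z.1 i i).
      apply: Ck_submxblock; first exact: openT.
      by apply: Ck_linear; first exact: findim_EG.
    exact: Ck_continuous C _.
  have c2 : {for diag_embed p, continuous (fun z => (rho z).2)}.
    apply: continuous_prod_topology => j.
    have C : Ck 0 setT (fun z : EG => submxblock z.2 j j).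
      apply: Ck_submxblock; first exact: openT.
      by apply: Ck_linear; first exact: findim_EG.
    exact: Ck_continuous C _.
  exact: (cvg_pair c1 c2).
- move=> p; rewrite /rho /k /=; congr (_, _);
  apply: functional_extensionality_dep => i;
    exact: submxblock_diag.
Qed.

(** Applying the polar factor to each component produces a point of the group
from arbitrary square matrices, and leaves the points of the group unchanged. *)
Definition polar_pair (Q : forall i, 'M[R]_(m i)) (S : forall j,
  'M[R]_(n j)) : G :=
  (exist _ (fun i => orth_polar (Q i))
     (mem_set ((fun i => (let: And5 _ _ _ h _ :=
       orth_polarP (m i) in h) (Q i)) :
       Oprod R m (fun i => orth_polar (Q i)))),
   exist _ (fun j => orth_polar (S j))
     (mem_set ((fun j => (let: And5 _ _ _ h _ :=
       orth_polarP (n j) in h) (S j)) :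
       Oprod R n (fun j => orth_polar (S j))))).

Lemma polar_pair_id (p : G) (Q : forall i, 'M[R]_(m i)) (S : forall j,
  'M[R]_(n j)) :
  (forall i, Q i = \val p.1 i) -> (forall j, S j = \val p.2 j) ->
    polar_pair Q S = p.
Proof.
case: p => p1 p2 /= HQ HS; congr (_, _); apply: val_inj => /=;
  apply: functional_extensionality_dep => i.
  by rewrite HQ; have [_ _ _ _ H] := orth_polarP (m i); have [] :=
    H _ (set_valP p1 i).
by rewrite HS; have [_ _ _ _ H] := orth_polarP (n i); have [] :=
  H _ (set_valP p2 i).
Qed.

Lemma smooth_polar_pair (V : normedModType R) (U : set V) (Q : forall i,
  V -> 'M[R]_(m i))
    (S : forall j, V -> 'M[R]_(n j)) : open U ->
  (forall i, smooth_on U (Q i)) -> (forall j, smooth_on U (S j)) ->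
  (forall x, U x -> (forall i, orth_polar_dom (Q i x)) /\ (forall j,
    orth_polar_dom (S j x))) ->
  smooth_on U (fun x => diag_embed (polar_pair (Q^~ x) (S^~ x))).
Proof.
move=> oU sQ sS dom k; apply: Ck_pair => //; apply: Ck_mxdiag => // i.
  have [oW _ sp _ _] := orth_polarP (m i).
  apply: (Ck_comp (findim_mx _ _) oU oW _ (sQ i k) (sp k)).
  by move=> x /dom[].
have [oW _ sp _ _] := orth_polarP (n i).
apply: (Ck_comp (findim_mx _ _) oU oW _ (sS i k) (sp k)).
by move=> x /dom[].
Qed.

Lemma open_forall (T : topologicalType) (I : finType) (P : I -> set T) :
  (forall i, open (P i)) -> open [set x | forall i, P i x].
Proof.
move=> oP; rewrite openE => x Px; apply: (@filter_forall _ _ P (nbhs x)) => i.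
by apply: open_nbhs_nbhs; split => //; exact: Px.
Qed.

Lemma diag_embed_retract p : smooth_retract_at diag_embed p.
Proof.
pose Q i (z : EG) := submxblock z.1 i i.
pose S j (z : EG) := submxblock z.2 j j.
have sQ i : smooth_on setT (Q i).
  move=> k; apply: Ck_submxblock; first exact: openT.
  by apply: Ck_linear; first exact: findim_EG.
have sS j : smooth_on setT (S j).
  move=> k; apply: Ck_submxblock; first exact: openT.
  by apply: Ck_linear; first exact: findim_EG.
pose W := [set z : EG | forall i,
  orth_polar_dom (Q i z)] `&` [set z | forall j, orth_polar_dom (S j z)].
have oW : open W.
  apply: openI; apply: open_forall => i.
    have [oW _ _ _ _] := orth_polarP (m i).
    by apply: open_comp => // z _; exact: smooth_continuous (sQ i) _.
  have [oW _ _ _ _] := orth_polarP (n i).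
  by apply: open_comp => // z _; exact: smooth_continuous (sS i) _.
have QiG i (y : G) : Q i (diag_embed y) = \val y.1 i by exact: submxblock_diag.
have SiG j (y : G) : S j (diag_embed y) = \val y.2 j by exact: submxblock_diag.
exists W, (fun z => diag_embed (polar_pair (Q^~ z) (S^~ z))); split => //.
- split=> i; rewrite /= ?QiG ?SiG.
    by have [_ H _ _ _] := orth_polarP (m i); exact/H/(set_valP p.1).
  by have [_ H _ _ _] := orth_polarP (n i); exact/H/(set_valP p.2).
- by apply: smooth_polar_pair => //; move=> i;
  apply: smooth_mono (sQ i) || apply: smooth_mono (sS i).
- by move=> z _; exists (polar_pair (Q^~ z) (S^~ z)).
- by move=> y _; congr diag_embed; apply: polar_pair_id => i.
Qed.

End OrthogonalGroups.

(** * Orthonormal frames *)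

Section OrthonormalBlocks.
Context {R : realType}.

Lemma gram_castmx m n n' (e : n = n') (Y : 'M[R]_(m, n)) :
  orthonormal_cols (castmx (erefl m, e) Y) <-> orthonormal_cols Y.
Proof. by case: _ / e; rewrite castmx_id. Qed.

Variables (q : nat) (q_ : 'I_q -> nat).

Lemma one_offdiag i j : i != j ->
  submxblock (1%:M : 'M[R]_(\sum_i q_ i)) i j = 0.
Proof. by move=> ij; rewrite -mxdiagZ mxblockK (negbTE ij). Qed.

Lemma one_diag i : submxblock (1%:M : 'M[R]_(\sum_i q_ i)) i i = 1%:M.
Proof. by rewrite -mxdiagZ submxblock_diag. Qed.

Lemma eq_mxdiag_block (D : forall i, 'M[R]_(q_ i)) (M : 'M[R]_(\sum_i q_ i)) :
  (forall i, submxblock M i i = D i) ->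
  (forall i j, i != j -> submxblock M i j = 0) -> M = \mxdiag_i D i.
Proof.
move=> Md Mo; apply/mxblockP => i j; rewrite mxblockK.
case: eqVneq => [<-|ij]; last exact: Mo.
by rewrite conform_mx_id.
Qed.

Lemma orthonormal_mxrow m (B : forall j, 'M[R]_(m, q_ j)) :
  (forall j, orthonormal_cols (B j)) ->
  (forall j j', j != j' -> (B j)^T *m B j' = 0) ->
    orthonormal_cols (\mxrow_j B j).
Proof.
move=> Bd Bo; rewrite /orthonormal_cols tr_mxrow mul_mxcol_mxrow -mxdiagZ.
apply: eq_mxdiag_block => [i|i j ij]; rewrite mxblockK; last exact: Bo.
exact: Bd.
Qed.

Lemma submxrow_gram m (Y : 'M[R]_(m, \sum_j q_ j)) j j' :
  (submxrow Y j)^T *m submxrow Y j' = submxblock (Y^T *m Y) j j'.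
Proof.
by rewrite -{3 4}(submxrowK Y) tr_mxrow mul_mxcol_mxrow mxblockK.
Qed.

Lemma submxrow_orthonormal m (Y : 'M[R]_(m, \sum_j q_ j)) j :
  orthonormal_cols Y -> orthonormal_cols (submxrow Y j).
Proof. by move=> oY; rewrite /orthonormal_cols submxrow_gram oY one_diag. Qed.

Lemma submxrow_orthogonal m (Y : 'M[R]_(m, \sum_j q_ j)) j j' :
  orthonormal_cols Y -> j != j' -> (submxrow Y j)^T *m submxrow Y j' = 0.
Proof. by move=> oY jj; rewrite submxrow_gram oY one_offdiag. Qed.

Lemma submxrow_cogram m (Y : 'M[R]_(m, \sum_j q_ j)) :
  \sum_j submxrow Y j *m (submxrow Y j)^T = Y *m Y^T.
Proof. by rewrite -{3 4}(submxrowK Y) tr_mxrow mul_mxrow_mxcol. Qed.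

End OrthonormalBlocks.

Section GramSchmidt.
Context {R : realType}.

Lemma gram_col_gt0 m (c : 'cV[R]_m) : c != 0 -> 0 < (c^T *m c) 0 0.
Proof.
move=> c0; have [i ci] : exists i, c i 0 != 0.
  apply/existsP; apply: contraNT c0; rewrite negb_exists => /forallP c0.
  by apply/eqP/colP => i; rewrite mxE; apply/eqP; have := c0 i; rewrite negbK.
rewrite mxE (bigD1 i) //= mxE; apply: ltr_pwDl.
  by rewrite -expr2 exprn_even_gt0 //= ci.
by apply: sumr_ge0 => j _; rewrite mxE -expr2 sqr_ge0.
Qed.

(** Gram-Schmidt: a matrix with a left inverse has an orthonormal basis of its
column space among its multiples. *)
Lemma gram_schmidt m r (C : 'M[R]_(m, r)) (D : 'M[R]_(r, m)) : D *m C = 1%:M ->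
  exists Z : 'M[R]_r, orthonormal_cols (C *m Z).
Proof.
move=> DC; suff : forall k, (k <= r)%N -> exists Z : 'M[R]_(r, k),
  orthonormal_cols (C *m Z).
  by move=> /(_ r (leqnn r)).
elim=> [|k IH] kr.
  by exists 0; rewrite /orthonormal_cols; apply/matrixP => -[].
have [Z oZ] := IH (ltnW kr).
pose Q := C *m Z; pose P := C - Q *m (Q^T *m C).
(* Otherwise [1 = D *m C] would factor through dimension [k < r]. *)
have P0 : P != 0.
  apply/negP => /eqP/subr0_eq CE.
  have : (\rank (1%:M : 'M[R]_r) <= k)%N.
    rewrite -DC CE mulmxA; apply: leq_trans (mulmx_max_rank _ _) _ => //.
  by rewrite mxrank1 leqNgt kr.
have QP : Q^T *m P = 0.
  by rewrite /P mulmxBr (mulmxA Q^T Q) (oZ : Q^T *m Q = _) mul1mx subrr.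
have [j Pj] : exists j, col j P != 0.
  apply/existsP; apply: contraNT P0; rewrite negb_exists => /forallP P0.
  apply/eqP/matrixP => i j; have := P0 j; rewrite negbK => /eqP/colP/(_ i).
  by rewrite !mxE.
pose c := col j P; pose nu := Num.sqrt ((c^T *m c) 0 0).
have nu0 : 0 < nu by rewrite sqrtr_gt0; exact: gram_col_gt0.
pose z : 'cV[R]_r := nu^-1 *: col j (1%:M - Z *m (Q^T *m C)).
have Cz : C *m z = nu^-1 *: c.
  rewrite /z /c -scalemxAr !colE (mulmxA C); congr (_ *: (_ *m _)).
  by rewrite mulmxBr mulmx1 (mulmxA C).
rewrite -addn1; exists (row_mx Z z).
rewrite /orthonormal_cols mul_mx_row Cz -/Q tr_row_mx mul_col_row.
have Qc : Q^T *m c = 0 by rewrite /c colE mulmxA QP mul0mx.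
rewrite -scalemxAr Qc scaler0 oZ.
have -> : (nu^-1 *: c)^T *m Q = 0.
  by apply: trmx_inj; rewrite trmx_mul trmxK -scalemxAr Qc scaler0 trmx0.
have -> : (nu^-1 *: c)^T *m (nu^-1 *: c) = 1%:M.
  rewrite -scalemxAr [X in _ *: (X *m _)]linearZ /= -scalemxAl scalerA.
  have nu2 : nu ^+ 2 = (c^T *m c) 0 0.
    by rewrite /nu sqr_sqrtr //; apply/ltW/gram_col_gt0.
  apply/matrixP => a b; rewrite (ord1 a) (ord1 b) [LHS]mxE -nu2 -expr2 exprVn.
  by rewrite mulVf ?mxE // expf_neq0 // gt_eqF.
by rewrite -scalar_mx_block.
Qed.

(** The columns of [X] span the range of the projection [X *m X^T], whose
dimension is its trace. *)
Lemma partial_isometry_frame m n (X : 'M[R]_(m, n)) : X *m X^T *m X = X ->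
  exists r (Z : 'M[R]_(n, r)), orthonormal_cols (X *m Z) /\ \tr (X *m X^T) =
    r%:R.
Proof.
move=> XX; have PP : X *m X^T *m (X *m X^T) = X *m X^T by rewrite mulmxA XX.
have [r [C [D [CD DC]]]] := idempotent_factor PP.
have [Z oZ] := gram_schmidt DC.
exists r, (X^T *m C *m Z); split; last by rewrite -CD mxtrace_mulC DC mxtrace1.
have -> : X *m (X^T *m C *m Z) = C *m Z; last exact: oZ.
by rewrite !mulmxA -CD -(mulmxA C) DC mulmx1.
Qed.

Lemma frame_trace m n r (Q : 'M[R]_(m, r)) (S : 'M[R]_(n, r)) :
  orthonormal_cols Q -> orthonormal_cols S ->
  \tr ((Q *m S^T) *m (Q *m S^T)^T) = r%:R.
Proof.
move=> oQ oS; rewrite trmx_mul trmxK mulmxA -(mulmxA Q) oS mulmx1.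
by rewrite mxtrace_mulC oQ mxtrace1.
Qed.

(** Two factorisations of the same partial isometry differ by an orthogonal
change of frame. *)
Lemma frames_unique m n r (Q Q' : 'M[R]_(m, r)) (S S' : 'M[R]_(n, r)) :
  orthonormal_cols Q -> orthonormal_cols S -> orthonormal_cols Q' ->
    orthonormal_cols S' ->
  Q *m S^T = Q' *m S'^T ->
  let U := Q^T *m Q' in [/\ O R r U, Q' = Q *m U & S' = S *m U].
Proof.
move=> oQ oS oQ' oS' E U.
have PE : Q *m Q^T = Q' *m Q'^T.
  have := congr1 (fun X => X *m X^T) E; rewrite !trmx_mul !trmxK !mulmxA.
  by rewrite -(mulmxA Q) oS -(mulmxA Q') oS' !mulmx1.
split.
- rewrite /O /= /U trmx_mul trmxK mulmxA -(mulmxA Q^T) -PE !mulmxA oQ mul1mx.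
  by rewrite oQ.
- by rewrite /U mulmxA PE -mulmxA oQ' mulmx1.
- have := congr1 (fun X => X^T *m Q') E; rewrite !trmx_mul !trmxK.
  by rewrite -(mulmxA S') oQ' mulmx1 mulmxA => ->.
Qed.

End GramSchmidt.

(** * Matrices with orthogonal blocks *)

Section BlockOrthogonality.
Context {R : realType}.

Lemma submxblock_mul p q r (p_ : 'I_p -> nat) (q_ : 'I_q ->
  nat) (r_ : 'I_r -> nat)
    (X : 'M[R]_(\sum_i p_ i, \sum_j q_ j)) (Y : 'M[R]_(\sum_j q_ j,
      \sum_k r_ k)) i k :
  submxblock (X *m Y) i k = \sum_j submxblock X i j *m submxblock Y j k.
Proof.
by rewrite -{1}(submxblockK X) -{1}(submxblockK Y) mul_mxblock mxblockK.
Qed.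

Lemma submxblock_tr p q (p_ : 'I_p -> nat) (q_ : 'I_q -> nat)
    (X : 'M[R]_(\sum_i p_ i, \sum_j q_ j)) i j :
  submxblock X^T j i = (submxblock X i j)^T.
Proof. by apply/matrixP => a b; rewrite !mxE. Qed.

Section OneSide.
Variables (s t : nat) (m : 'I_s -> nat) (n : 'I_t -> nat).
Variables (a : 'I_s -> R) (b : 'I_t -> R).

Let A : 'M[R]_(\sum_i m i) := \mxdiag_i (a i)%:M.
Let B : 'M[R]_(\sum_j n j) := \mxdiag_j (b j)%:M.

Implicit Type X : 'M[R]_(\sum_i m i, \sum_j n j).

Definition column_blocks_orthogonal X := forall i j j', j != j' ->
  (submxblock X i j)^T *m submxblock X i j' = 0.

Definition row_blocks_orthogonal X := forall i i' j, i != i' ->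
  submxblock X i j *m (submxblock X i' j)^T = 0.

Lemma tr_diag_scalar : B^T = B.
Proof. by rewrite /B tr_mxdiag; apply: eq_mxdiag => j;
  rewrite tr_scalar_mx. Qed.

(** A matrix commuting with [A] is block diagonal, so the columns of the block
[(i, j)] of [X] are eigenvectors, for [b j], of the [i]-th diagonal block of the
symmetric matrix [X *m B *m X^T]; eigenvectors for distinct eigenvalues are
orthogonal. *)
Lemma commute_column_blocks X : injective a -> injective b ->
  X^T *m X = 1%:M -> A *m X *m B *m X^T = X *m B *m X^T *m A ->
  column_blocks_orthogonal X.
Proof.
move=> inja injb XX com.
pose C := X *m B *m X^T.
have symC : C^T = C by rewrite /C !trmx_mul trmxK tr_diag_scalar mulmxA.
have {}com : A *m C = C *m A by rewrite /C !mulmxA.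
have Coff i k : i != k -> submxblock C i k = 0.
  move=> ik; have := congr1 (fun M => submxblock M i k) com.
  rewrite -{1 2}(submxblockK C) mul_mxdiag_mxblock mul_mxblock_mxdiag !mxblockK.
  rewrite mul_scalar_mx mul_mx_scalar => /eqP; rewrite -subr_eq0 -scalerBl.
  by rewrite scaler_eq0 subr_eq0 (inj_eq inja) (negbTE ik) => /eqP.
have CX : C *m X = X *m B by rewrite /C -mulmxA XX mulmx1.
have eig i j : submxblock C i i *m submxblock X i j = b j *: submxblock X i j.
  have := congr1 (fun M => submxblock M i j) CX.
  rewrite submxblock_mul (bigD1 i) //= big1 ?addr0 => [->|k ki]; last first.
    by rewrite Coff 1?eq_sym // mul0mx.
  by rewrite -{1}(submxblockK X) mul_mxblock_mxdiag mxblockK mul_mx_scalar.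
have symCi i : (submxblock C i i)^T = submxblock C i i.
  by rewrite -submxblock_tr symC.
move=> i j j' jj.
have E : (b j - b j') *: ((submxblock X i j)^T *m submxblock X i j') = 0.
  rewrite scalerBl (scalemxAr (b j')) -eig mulmxA -{1}symCi -trmx_mul eig.
  by rewrite linearZ /= -scalemxAl subrr.
move/eqP: E; rewrite scaler_eq0 subr_eq0 (inj_eq injb) (negbTE jj) /=.
by move/eqP.
Qed.

Lemma row_blocks_commute X : row_blocks_orthogonal X ->
  A *m X *m B *m X^T = X *m B *m X^T *m A.
Proof.
move=> ro; pose C := X *m B *m X^T.
suff : A *m C = C *m A by rewrite /C !mulmxA.
apply/mxblockP => i k.
rewrite -(submxblockK C) mul_mxdiag_mxblock mul_mxblock_mxdiag !mxblockK.
have [<-|ik] := eqVneq i k; first by rewrite scalar_mxC.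
suff -> : submxblock C i k = 0 by rewrite mulmx0 mul0mx.
rewrite /C submxblock_mul big1 // => j _.
rewrite -{1}(submxblockK X) mul_mxblock_mxdiag mxblockK mul_mx_scalar.
by rewrite submxblock_tr -scalemxAl ro // scaler0.
Qed.

End OneSide.

Lemma row_column_blocks s t (m : 'I_s -> nat) (n : 'I_t -> nat)
    (X : 'M[R]_(\sum_i m i, \sum_j n j)) :
  column_blocks_orthogonal X^T -> row_blocks_orthogonal X.
Proof.
move=> H i i' j ii; have := H j i i' ii.
by rewrite !submxblock_tr trmxK.
Qed.

Lemma commute_blocks s t (m : 'I_s -> nat) (n : 'I_t -> nat) (a : 'I_s -> R)
    (b : 'I_t -> R) (X : 'M[R]_(\sum_i m i, \sum_j n j)) :
  let A := \mxdiag_i (a i)%:M in let B := \mxdiag_j (b j)%:M in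
  injective a -> injective b -> X *m X^T = 1%:M -> X^T *m X = 1%:M ->
  A *m X *m B *m X^T = X *m B *m X^T *m A <->
  column_blocks_orthogonal X /\ row_blocks_orthogonal X.
Proof.
move=> A B inja injb XX' XX; split=> [com|[_ ro]];
  last exact: row_blocks_commute.
split; first exact: commute_column_blocks inja injb XX com.
apply: row_column_blocks; apply: (commute_column_blocks injb inja);
  rewrite trmxK //.
have := congr1 (fun M => X^T *m M *m X) com; rewrite !mulmxA XX mul1mx.
by rewrite -[X in X = _]mulmxA XX mulmx1 => ->.
Qed.

Section Frames.
Variables (s t : nat) (m : 'I_s -> nat) (n : 'I_t -> nat).
Variable X : 'M[R]_(\sum_i m i, \sum_j n j).
Hypotheses (XX' : X *m X^T = 1%:M) (XX : X^T *m X = 1%:M).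
Hypotheses (co : column_blocks_orthogonal X) (ro : row_blocks_orthogonal X).

Lemma block_row_sum i : \sum_j submxblock X i j *m (submxblock X i j)^T = 1%:M.
Proof.
have := congr1 (fun M => submxblock M i i) XX';
  rewrite one_diag submxblock_mul => <-.
by apply: eq_bigr => j _; rewrite submxblock_tr.
Qed.

Lemma block_col_sum j : \sum_i (submxblock X i j)^T *m submxblock X i j = 1%:M.
Proof.
have := congr1 (fun M => submxblock M j j) XX;
  rewrite one_diag submxblock_mul => <-.
by apply: eq_bigr => i _; rewrite submxblock_tr.
Qed.

Lemma block_partial_isometry i j :
  submxblock X i j *m (submxblock X i j)^T *m submxblock X i j =
    submxblock X i j.
Proof.
have := congr1 (mulmx^~ (submxblock X i j)) (block_row_sum i).
rewrite mul1mx mulmx_suml (bigD1 j) //= big1 ?addr0 // => k kj.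
by rewrite -mulmxA co // mulmx0.
Qed.

Lemma orthonormal_square k l (Y : 'M[R]_(k, l)) : k = l ->
  orthonormal_cols Y -> Y *m Y^T = 1%:M.
Proof. by move=> e; case: _ / e Y => Y /mulmx1C. Qed.

Variable e : 'I_s -> 'I_t -> nat.
Hypothesis row_sum : forall i, m i = (\sum_j e i j)%N.
Variable Z : forall i j, 'M[R]_(n j, e i j).

Let Q i j := submxblock X i j *m Z i j.
Let S i j := (submxblock X i j)^T *m Q i j.
Hypothesis oQ : forall i j, orthonormal_cols (Q i j).

Lemma frames_Q i : orthonormal_cols (\mxrow_j Q i j).
Proof.
apply: orthonormal_mxrow => // j j' jj.
by rewrite /Q trmx_mul -mulmxA (mulmxA _ _ (Z i j')) co // mul0mx mulmx0.
Qed.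

Lemma frames_S j : orthonormal_cols (\mxrow_i S i j).
Proof.
apply: orthonormal_mxrow => [i|i i' ii].
  rewrite /orthonormal_cols /S trmx_mul trmxK -mulmxA.
  rewrite (_ : submxblock X i j *m _ = Q i j) ?oQ //.
  by rewrite /Q !mulmxA block_partial_isometry.
by rewrite /S trmx_mul trmxK -mulmxA (mulmxA (submxblock X i j)) ro // mul0mx
  mulmx0.
Qed.

(** For fixed [i] the frames [Q i k] together form a square matrix with
orthonormal columns, so that [\sum_k Q i k *m (Q i k)^T] is the identity; only
the summand [k = j] does not kill the block [(i, j)]. *)
Lemma frames_QS i j : Q i j *m (S i j)^T = submxblock X i j.
Proof.
rewrite /S trmx_mul trmxK mulmxA.
have H := orthonormal_square (row_sum i) (frames_Q i).
rewrite tr_mxrow mul_mxrow_mxcol in H.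
have := congr1 (mulmx^~ (submxblock X i j)) H.
rewrite mul1mx mulmx_suml (bigD1 j) //= big1 ?addr0 // => k kj.
by rewrite {2}/Q trmx_mul -!mulmxA co // !mulmx0.
Qed.

End Frames.

End BlockOrthogonality.

(** * Critical points of the trace function *)

Section CriticalPoints.
Context {R : realType}.

Lemma gram_trace_eq0 m n (K : 'M[R]_(m, n)) : \tr (K^T *m K) = 0 -> K = 0.
Proof.
move=> trK; apply/matrixP => i j; rewrite mxE.
have ge0 j' : 0 <= (K^T *m K) j' j'.
  by rewrite mxE; apply: sumr_ge0 => k _; rewrite mxE -expr2 sqr_ge0.
have /eqP := trK; rewrite /mxtrace psumr_eq0 // => /allP /(_ j).
rewrite mem_index_enum => /(_ isT) /=; rewrite mxE psumr_eq0 =>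
  [/allP/(_ i)|k _].
  rewrite mem_index_enum => /(_ isT) /=; rewrite mxE -expr2 sqrf_eq0.
  by move/eqP.
by rewrite mxE -expr2 sqr_ge0.
Qed.

Variables (N : nat) (A B : 'M[R]_N).

Let f (Y : 'M[R]_N) : R := \tr (A *m Y *m B *m Y^T).
Let D (X Z : 'M[R]_N) : R := \tr (A *m X *m B *m Z^T + A *m Z *m B *m X^T).

Lemma trace_fun_diff X : is_diff X f (D X).
Proof.
have fM : findim 'M[R]_N by exact: findim_mx.
have d1 : is_diff X (fun Y : 'M[R]_N => A *m Y *m B) (fun Y => A *m Y *m B).
  apply: findim_is_diff_linear => // a Y Z.
  by rewrite mulmxDr mulmxDl -scalemxAr -scalemxAl.
have d2 : is_diff X (@trmx R N N) (@trmx R N N).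
  by apply: findim_is_diff_linear => // a Y Z; rewrite linearP.
have d3 := is_diff_mulmx d1 d2.
have d4 := @findim_is_diff_linear R _ R (fun Y : 'M[R]_N => \tr Y)
  (A *m X *m B *m X^T) fM (fun a Y Z => linearP (@mxtrace R N) a Y Z).
exact: (is_diff_comp d3 d4).
Qed.

Hypotheses (symA : A^T = A) (symB : B^T = B).

Lemma trace_diff_skew X S : S^T = - S ->
  D X (S *m X) = \tr (S *m (X *m B *m X^T *m A - A *m X *m B *m X^T)).
Proof.
move=> skS; rewrite /D mxtraceD addrC mulmxBr mxtraceD raddfN /=; congr (_ + _).
  rewrite (_ : A *m (S *m X) *m B *m X^T = A *m (S *m (X *m B *m X^T))).
    by rewrite mxtrace_mulC !mulmxA.
  by rewrite !mulmxA.
by rewrite trmx_mul skS !mulmxN raddfN /= mulmxA mxtrace_mulC.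
Qed.

(** Tangent vectors satisfy the equation obtained by differentiating
[Y *m Y^T = 1]. *)
Lemma chart_tangent (X : O R N) (c : chart R (O R N)) v : O_atlas (R :=
  R) (n := N) c ->
  dom c X -> exists2 S, S^T = - S &
    'd ((fun Y : O R N => \val Y) \o param c) (coord c X) v = S *m \val X.
Proof.
move=> [[od ocd pk cc cp] sc inj] dX.
set phi := (_ \o _); set y0 := coord c X; set Z := 'd _ _ _.
have cy : codom_of (c := c) y0 by exists X.
have XX : (\val X) *m (\val X)^T = 1%:M by exact: (set_valP X).
have phiX : phi y0 = \val X by rewrite /phi /= /y0 pk.
have dphi := differentiableP (smooth_differentiable sc cy).
have fM : findim 'M[R]_N by exact: findim_mx.
have dtr : is_diff (phi y0) (@trmx R N N) (@trmx R N N).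
  by apply: findim_is_diff_linear => // a U V; rewrite linearP.
have H := is_diff_mulmx dphi (is_diff_comp dphi dtr).
have H1 : is_diff y0 (fun=> 1%:M : 'M[R]_N) (fun v =>
  phi y0 *m ('d phi y0 v)^T + 'd phi y0 v *m (phi y0)^T).
  apply: near_is_diff H; apply: (@filterE _ (nbhs y0)) => y /=.
  exact: (set_valP (param c y)).
have ZX : \val X *m Z^T + Z *m (\val X)^T = 0.
  have E0 := diff_val (is_diff_def := is_diff_cst (1%:M : 'M[R]_N) y0).
  have := congr1 (@^~ v) (etrans (esym E0) (diff_val (is_diff_def := H1))).
  by rewrite phiX => <-.
exists (Z *m (\val X)^T).
  by rewrite trmx_mul trmxK; apply/eqP; rewrite -addr_eq0 ZX.
by rewrite -mulmxA (mulmx1C XX) mulmx1.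
Qed.

(** The polar retraction fixes [S *m X] to first order and factors through any
chart around [X]. *)
Lemma skew_tangent (X : O R N) (c : chart R (O R N)) S : O_atlas (R :=
  R) (n := N) c ->
  dom c X -> S^T = - S -> exists v,
    'd ((fun Y : O R N => \val Y) \o param c) (coord c X) v = S *m \val X.
Proof.
move=> ac dX skS; have [[od ocd pk cc cp] sc inj] := ac.
have [oW OW sp Op polO] := orth_polarP (R := R) N.
pose rho (Y : 'M[R]_N) : O R N := exist _ (orth_polar Y) (mem_set (Op Y)).
have fM : findim 'M[R]_N by exact: findim_mx.
have rhoX : rho (\val X) = X.
  by apply: val_inj => /=; have [] := polO _ (set_valP X).
have WX : orth_polar_dom (\val X) by exact/OW/set_valP.
have crho Y : orth_polar_dom Y -> {for Y, continuous rho}.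
  move=> WY; apply: (embedding_continuous (@O_embedding R N)).
  exact: smooth_continuous sp WY.
pose U := orth_polar_dom (n := N) `&` rho @^-1` dom c.
have oU : open U by exact: open_preimageI.
have UX : U (\val X) by split => //=; rewrite rhoX.
have sl : smooth_on U (coord c \o rho).
  apply: (embedded_coord_smooth fM ac) => //.
  - by move=> Y [WY _]; exact: crho.
  - by move=> Y [].
  - by apply: (smooth_mono _ sp) => Y [].
have dl := differentiableP (smooth_differentiable sl UX).
have lX : (coord c \o rho) (\val X) = coord c X by rewrite /= rhoX.
have dphi : is_diff ((coord c \o rho) (\val X)) ((fun Y : O R N =>
  \val Y) \o param c)
    ('d ((fun Y : O R N => \val Y) \o param c) (coord c X)).
  rewrite lX; apply: differentiableP; apply: smooth_differentiable sc _.
  by exists X.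
have H := is_diff_comp dl dphi.
have nE : \forall Y \near \val X,
    ((fun Y : O R N => \val Y) \o param c \o (coord c \o rho)) Y = orth_polar Y.
  apply: (@filterS _ (nbhs (\val X))) (open_nbhs_nbhs (conj oU UX)) =>
    Y [WY dY] /=.
  by rewrite pk.
have H1 := near_is_diff nE H.
exists ('d (coord c \o rho) (\val X) (S *m \val X)).
have [_ /(_ (S *m \val X))] := polO _ (set_valP X).
move=> E; rewrite -[RHS]E; last first.
  by rewrite trmx_mul skS mulmxN mulNmx mulmxA addNr.
exact: (esym (congr1 (@^~ (S *m \val X)) (diff_val (is_diff_def := H1)))).
Qed.

(** In the direction [S *m X], with [S] skew, the derivative of the trace
function is [\tr (S *m K)], where [K] is the commutator of [X *m B *m X^T] and
[A]. This commutator is itself skew, so [S = K^T] is allowed, and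
[\tr (K^T *m K) = 0] forces [K = 0]. *)
Lemma critical_commuteP (X : O R N) : critical_locus A B X <->
  A *m \val X *m B *m (\val X)^T = \val X *m B *m (\val X)^T *m A.
Proof.
have fchart c : O_atlas (R := R) (n := N) c -> dom c X ->
    is_diff (coord c X) (trace_fun A B \o param c)
      (D (\val X) \o 'd ((fun Y : O R N => \val Y) \o param c) (coord c X)).
  move=> [[od ocd pk cc cp] sc _] dX.
  have cX : codom_of (c := c) (coord c X) by exists X.
  have dphi := differentiableP (smooth_differentiable sc cX).
  have df : is_diff (((fun Y : O R N => \val Y) \o
    param c) (coord c X)) f (D (\val X)).
    by rewrite /= pk //; exact: trace_fun_diff.
  exact: (is_diff_comp dphi df).
split=> [crit|com c ac dX].
  have [c ac dX] := smooth_retract_chart (findim_mx N N) (@O_embedding R N)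
    (O_retract X).
  set K := \val X *m B *m (\val X)^T *m A - A *m \val X *m B *m (\val X)^T.
  have skK : K^T = - K.
    by rewrite /K linearB /= !trmx_mul !trmxK symA symB !mulmxA opprB.
  have skK' : (K^T)^T = - K^T by rewrite trmxK skK opprK.
  have [v Ev] := skew_tangent ac dX skK'.
  have Dv : D (\val X) (K^T *m \val X) = 0.
    have := diff_val (is_diff_def := fchart _ ac dX).
    have -> := diff_val (is_diff_def := crit c ac dX).
    by move=> /(congr1 (@^~ v)) /=; rewrite Ev => <-.
  rewrite trace_diff_skew // in Dv; have /subr0_eq -> // := gram_trace_eq0 Dv.
have -> : 0 = D (\val X) \o 'd ((fun Y : O R N => \val Y) \o
  param c) (coord c X) :> (_ -> R).
  apply/funext => v /=; have [S skS ->] := chart_tangent v ac dX.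
  by rewrite trace_diff_skew // com subrr mulmx0 linear0.
exact: fchart.
Qed.

End CriticalPoints.

(** * The map Phi and its local sections *)

Section PhiMap.
Context {R : realType} {s t : nat} {m : 'I_s -> nat} {n : 'I_t ->
  nat} {N : nat}.
Variables (hm : (\sum_i m i)%N = N) (hn : (\sum_j n j)%N = N).

Local Notation G := (Oprod R m * Oprod R n)%type.
Local Notation EG := ('M[R]_(\sum_i m i) * 'M[R]_(\sum_j n j))%type.

Definition unblock (X : 'M[R]_N) : 'M[R]_(\sum_i m i, \sum_j n j) :=
  castmx (esym hm, esym hn) X.

Lemma O_unblock X : O R N X <->
  unblock X *m (unblock X)^T = 1%:M /\ (unblock X)^T *m unblock X = 1%:M.
Proof.
rewrite /unblock; case: _ / hm hn X => hn' X; rewrite trmx_cast /=.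
have -> : castmx (esym erefl, esym hn') X *m castmx (esym hn',
  esym erefl) X^T = X *m X^T.
  by case: _ / (esym hn'); rewrite !castmx_id.
have -> : castmx (esym hn', esym erefl) X^T *m castmx (esym erefl,
  esym hn') X = 1%:M <->
    X^T *m X = 1%:M.
  by case: _ / (esym hn'); rewrite !castmx_id.
by split=> [XX|[]//]; split=> //; exact: mulmx1C.
Qed.

Lemma commute_unblock (A : 'M[R]_(\sum_i m i)) (B : 'M[R]_(\sum_j n j)) X :
  castmx (hm, hm) A *m X *m castmx (hn, hn) B *m X^T =
  X *m castmx (hn, hn) B *m X^T *m castmx (hm, hm) A <->
  A *m unblock X *m B *m (unblock X)^T = unblock X *m B *m (unblock X)^T *m A.
Proof.
rewrite /unblock; move: A B.
move: (\sum_i m i)%N (\sum_j n j)%N hm hn => k l hk hl; subst k; subst l => A B.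
by rewrite !castmx_id.
Qed.

Definition block_orthogonal (X : 'M[R]_N) :=
  [/\ O R N X, column_blocks_orthogonal (unblock X) &
    row_blocks_orthogonal (unblock X)].

Lemma critical_locus_blocks (a : 'I_s -> R) (b : 'I_t -> R) (X : O R N) :
  injective a -> injective b ->
  let A : 'M[R]_N := castmx (hm, hm) (\mxdiag_i (a i)%:M) in
  let B : 'M[R]_N := castmx (hn, hn) (\mxdiag_j (b j)%:M) in
  critical_locus A B X <-> block_orthogonal (\val X).
Proof.
move=> inja injb A B.
have symA : A^T = A by rewrite /A trmx_cast /= tr_diag_scalar.
have symB : B^T = B by rewrite /B trmx_cast /= tr_diag_scalar.
have OX : O R N (\val X) by exact: set_valP.
have [XX' XX] := (O_unblock (\val X)).1 OX.
rewrite critical_commuteP // commute_unblock.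
by split=> [/(commute_blocks inja injb XX' XX)[]|[_ co ro]];
  last exact/(commute_blocks inja injb XX' XX).
Qed.

Section Filling.
Variable e : perfect_filling m n.

Definition filling_row i : m i = (\sum_j \val e i j)%N :=
  esym ((set_valP e).1 i).
Definition filling_col j : n j = (\sum_i \val e i j)%N :=
  esym ((set_valP e).2 j).

Lemma orthonormal_fst (p : G) i : orthonormal_cols (\val p.1 i).
Proof. exact/O_orthonormal/(set_valP p.1). Qed.

Lemma orthonormal_snd (p : G) j : orthonormal_cols (\val p.2 j).
Proof. exact/O_orthonormal/(set_valP p.2). Qed.

Lemma Qblock_orthonormal (p : G) i j : orthonormal_cols (Qblock e p i j).
Proof. by apply: submxrow_orthonormal; rewrite gram_castmx;
  exact: orthonormal_fst. Qed.

Lemma Rblock_orthonormal (p : G) i j : orthonormal_cols (Rblock e p i j).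
Proof. by apply: (@submxrow_orthonormal _ _ (fun i => \val e i j));
  rewrite gram_castmx; exact: orthonormal_snd. Qed.

Lemma Qblock_orthogonal (p : G) i j j' : j != j' ->
  (Qblock e p i j)^T *m (Qblock e p i j') = 0.
Proof. by apply: submxrow_orthogonal; rewrite gram_castmx;
  exact: orthonormal_fst. Qed.

Lemma Rblock_orthogonal (p : G) i i' j : i != i' ->
  (Rblock e p i j)^T *m (Rblock e p i' j) = 0.
Proof. move=> ii; apply: (@submxrow_orthogonal _ _ (fun i => \val e i j)) ii;
  rewrite gram_castmx; exact: orthonormal_snd. Qed.

Lemma Qblock_complete (p : G) i :
  \sum_j Qblock e p i j *m (Qblock e p i j)^T = 1%:M.
Proof.
rewrite submxrow_cogram; apply: orthonormal_square; first exact: filling_row.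
by rewrite gram_castmx; exact: orthonormal_fst.
Qed.

Lemma Phi_block (p : G) i j :
  submxblock (unblock (Phi e hm hn p)) i j =
    Qblock e p i j *m (Rblock e p i j)^T.
Proof. by rewrite /unblock /Phi castmxK mxblockK. Qed.

Lemma eq_Phi_blocks (p : G) X :
  (forall i j, submxblock (unblock X) i j =
    Qblock e p i j *m (Rblock e p i j)^T) ->
  Phi e hm hn p = X.
Proof.
move=> H; rewrite -[RHS](castmxKV hm hn) -/(unblock X) /Phi; congr castmx.
by apply/mxblockP => i j; rewrite mxblockK H.
Qed.

Lemma Phi_block_orthogonal (p : G) : block_orthogonal (Phi e hm hn p).
Proof.
have ro : row_blocks_orthogonal (unblock (Phi e hm hn p)).
  move=> i i' j ii; rewrite !Phi_block trmx_mul trmxK mulmxA -(mulmxA (Qblock _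
    _ _ _)).
  by rewrite Rblock_orthogonal // mulmx0 mul0mx.
split=> //; last first.
  move=> i j j' jj; rewrite !Phi_block trmx_mul trmxK mulmxA -(mulmxA (Rblock _
    _ _ _)).
  by rewrite Qblock_orthogonal // mulmx0 mul0mx.
have XX : unblock (Phi e hm hn p) *m (unblock (Phi e hm hn p))^T = 1%:M.
  rewrite -mxdiagZ; apply: eq_mxdiag_block => [i|i i' ii];
    rewrite submxblock_mul.
    rewrite -[RHS](Qblock_complete p i); apply: eq_bigr => j _.
    rewrite submxblock_tr Phi_block trmx_mul trmxK mulmxA -(mulmxA (Qblock _ _
      _ _)).
    by rewrite Rblock_orthonormal mulmx1.
  by apply: big1 => j _; rewrite submxblock_tr ro.
apply/O_unblock; split=> //; move: XX; move: (unblock _).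
have -> : (\sum_i m i)%N = (\sum_j n j)%N by rewrite hm hn.
by move=> Y /mulmx1C.
Qed.

Lemma same_orbit_Phi (p q : G) : same_orbit e p q -> Phi e hm hn p =
  Phi e hm hn q.
Proof.
move=> /asboolP[U UO pq]; apply: eq_Phi_blocks => i j; rewrite Phi_block.
have [-> ->] := pq i j; pose u : 'M[R]_(\val e i j) := U (i, j).
have uu : u *m u^T = 1%:M by exact: (UO (i, j)).
by rewrite -/u trmx_mul mulmxA -(mulmxA (Qblock e p i j)) uu mulmx1.
Qed.

Lemma Phi_same_orbit (p q : G) : Phi e hm hn p = Phi e hm hn q ->
  same_orbit e p q.
Proof.
move=> pq; apply/asboolP.
exists (fun ij => (Qblock e p ij.1 ij.2)^T *m (Qblock e q ij.1 ij.2)).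
  move=> [i j] /=; have [] := frames_unique (Qblock_orthonormal p i j)
    (Rblock_orthonormal p i j)
    (Qblock_orthonormal q i j) (Rblock_orthonormal q i j) => //.
  by rewrite -!Phi_block pq.
move=> i j; have [] := frames_unique (Qblock_orthonormal p i j)
  (Rblock_orthonormal p i j)
    (Qblock_orthonormal q i j) (Rblock_orthonormal q i j) => //.
by rewrite -!Phi_block pq.
Qed.

(** [Phi] is the restriction of this polynomial map to the group, which is how
its smoothness is expressed. *)
Definition Phi_ext (z : EG) : 'M[R]_N :=
  castmx (hm, hn) (\mxblock_(i, j)
    (submxrow (castmx (erefl, filling_row i) (submxblock z.1 i i)) j *m
     (submxrow (castmx (erefl, filling_col j) (submxblock z.2 j j)) i)^T)).

Lemma Phi_extE (p : G) : Phi_ext (diag_embed p) = Phi e hm hn p.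
Proof.
rewrite /Phi_ext /Phi; congr castmx; apply/mxblockP => i j.
by rewrite [LHS]mxblockK [RHS]mxblockK /diag_embed /= !submxblock_diag.
Qed.

Lemma smooth_Phi_ext : smooth_on setT Phi_ext.
Proof.
move=> k; have o := @openT EG.
have fE : findim EG by exact: findim_EG.
apply: Ck_castmx => //; apply: Ck_mxblock => // i j; apply: Ck_mulmx => //.
  apply: Ck_submxrow => //; apply: Ck_castmx => //; apply: Ck_submxblock => //.
  by apply: Ck_linear.
apply: Ck_trmx => //.
apply: Ck_submxrow => //; apply: Ck_castmx => //; apply: Ck_submxblock => //.
by apply: Ck_linear.
Qed.

Section Assemble.
Variables (Q : forall i j, 'M[R]_(m i, \val e i j)) (S : forall i j,
  'M[R]_(n j, \val e i j)).

Definition assembleQ i : 'M[R]_(m i) :=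
  castmx (erefl, esym (filling_row i)) (\mxrow_j Q i j).
Definition assembleS j : 'M[R]_(n j) :=
  castmx (erefl, esym (filling_col j)) (\mxrow_i S i j).

Lemma assemble_blocks :
  (forall i, orthonormal_cols (\mxrow_j Q i j)) ->
  (forall j, orthonormal_cols (\mxrow_i S i j)) ->
  forall i j, Qblock e (polar_pair assembleQ assembleS) i j = Q i j /\
              Rblock e (polar_pair assembleQ assembleS) i j = S i j.
Proof.
move=> oQ oS i j.
have HQ : \val (polar_pair assembleQ assembleS).1 i = assembleQ i.
  have oA : O R (m i) (assembleQ i).
    by apply/O_orthonormal; rewrite gram_castmx.
  by have [_ _ _ _ polO] := orth_polarP (R := R) (m i); have [] := polO _ oA.
have HS : \val (polar_pair assembleQ assembleS).2 j = assembleS j.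
  have oA : O R (n j) (assembleS j).
    by apply/O_orthonormal; rewrite gram_castmx.
  by have [_ _ _ _ polO] := orth_polarP (R := R) (n j); have [] := polO _ oA.
by split; rewrite /Qblock /Rblock ?HQ ?HS /assembleQ /assembleS castmx_comp
  castmx_id mxrowK.
Qed.

End Assemble.

(** Near [Phi p0], an orthonormal frame of the column space of each block is
obtained by projecting the corresponding block of [p0] and taking its polar
factor; multiplying by the transposed block gives the other frame. *)
Lemma Phi_section (p0 : G) : exists (W : set 'M[R]_N) (sigma : 'M[R]_N -> G),
  [/\ open W, W (Phi e hm hn p0), smooth_on W (@diag_embed R s t m n \o sigma),
      sigma (Phi e hm hn p0) = p0 &
      forall X, W X -> block_orthogonal X -> Phi e hm hn (sigma X) = X].
Proof.
have fM : findim 'M[R]_N by exact: findim_mx.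
pose polar i j := cid (smooth_polar (R := R) (m i) (\val e i j)).
pose Wp i j := sval (polar i j).
pose pol i j := sval (cid (svalP (polar i j))).
have polarP i j : exists isq,
  [/\ open (Wp i j), forall Y, orthonormal_cols Y -> Wp i j Y /\ pol i j Y = Y,
    smooth_on (Wp i j) (pol i j), forall Y, Wp i j Y ->
      orthonormal_cols (pol i j Y) &
    (forall Y, pol i j Y = Y *m isq (Y^T *m Y)) /\
    forall Y, orthonormal_cols Y -> forall Z, Z^T *m Y + Y^T *m Z = 0 ->
      'd (pol i j) Y Z = Z].
  exact: svalP (cid (svalP (polar i j))).
set X0 := Phi e hm hn p0.
pose Y i j (X : 'M[R]_N) := submxblock (unblock X) i j *m Rblock e p0 i j.
pose Q i j X := pol i j (Y i j X).
pose S i j X := (submxblock (unblock X) i j)^T *m Q i j X.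
have oT := @openT 'M[R]_N.
have idC k : Ck k setT (fun X : 'M[R]_N => X) by apply: Ck_linear.
have sblk i j k : Ck k setT (fun X : 'M[R]_N => submxblock (unblock X) i j).
  by apply: Ck_submxblock => //; apply: Ck_castmx.
have sY i j k : Ck k setT (Y i j).
  by apply: Ck_mulmx => //; exact: Ck_cst.
have Y0 i j : Y i j X0 = Qblock e p0 i j.
  by rewrite /Y Phi_block -mulmxA Rblock_orthonormal mulmx1.
have Q0 i j : Q i j X0 = Qblock e p0 i j.
  rewrite /Q Y0; have [isq [_ H _ _ _]] := polarP i j.
  by have [_ ->] := H _ (Qblock_orthonormal p0 i j).
have S0 i j : S i j X0 = Rblock e p0 i j.
  by rewrite /S Q0 Phi_block trmx_mul trmxK -mulmxA Qblock_orthonormal mulmx1.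
pose W1 := [set X : 'M[R]_N | forall i, forall j, Wp i j (Y i j X)].
have oW1 : open W1.
  apply: open_forall => i; apply: open_forall => j.
  have [isq [oW _ _ _ _]] := polarP i j.
  by apply: open_comp => // X _; exact: (Ck_continuous (sY i j 0%N)).
have W1X0 : W1 X0.
  move=> i j; have [isq [_ H _ _ _]] := polarP i j; rewrite Y0.
  by have [] := H _ (Qblock_orthonormal p0 i j).
have sQ i j : smooth_on W1 (Q i j).
  move=> k; have [isq [oW _ sp _ _]] := polarP i j.
  apply: (Ck_comp (findim_mx _ _) oW1 oW) (sp k); first by move=> X; exact.
  by apply: Ck_mono (sY i j k).
have sS i j : smooth_on W1 (S i j).
  move=> k; apply: Ck_mulmx => //; last exact: sQ.
  by apply: Ck_trmx => //; apply: Ck_mono (sblk i j k).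
pose aQ i X := assembleQ (fun i j => Q i j X) i.
pose aS j X := assembleS (fun i j => S i j X) j.
have saQ i : smooth_on W1 (aQ i).
  by move=> k; apply: Ck_castmx => //; apply: Ck_mxrow => // j; exact: sQ.
have saS j : smooth_on W1 (aS j).
  by move=> k; apply: Ck_castmx => //; apply: Ck_mxrow => // i; exact: sS.
have aQ0 i : aQ i X0 = \val p0.1 i.
  rewrite /aQ /assembleQ; have -> : \mxrow_j Q i j X0 =
      castmx (erefl, filling_row i) (\val p0.1 i).
    by rewrite -[RHS]submxrowK; apply: eq_mxrow => j; rewrite Q0.
  by rewrite castmx_comp castmx_id.
have aS0 j : aS j X0 = \val p0.2 j.
  rewrite /aS /assembleS; have -> : \mxrow_i S i j X0 =
      castmx (erefl, filling_col j) (\val p0.2 j).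
    by rewrite -[RHS]submxrowK; apply: eq_mxrow => i; rewrite S0.
  by rewrite castmx_comp castmx_id.
pose W := W1 `&` ([set X | forall i, W1 X /\ orth_polar_dom (aQ i X)] `&`
                  [set X | forall j, W1 X /\ orth_polar_dom (aS j X)]).
have oW : open W.
  apply: openI => //; apply: openI; apply: open_forall => i.
    have [oW _ _ _ _] := orth_polarP (R := R) (m i).
    apply: (open_preimageI oW1 oW) => X WX;
      exact: (smooth_continuous (saQ i) WX).
  have [oW _ _ _ _] := orth_polarP (R := R) (n i).
  apply: (open_preimageI oW1 oW) => X WX; exact: (smooth_continuous (saS i) WX).
exists W, (fun X => polar_pair (aQ^~ X) (aS^~ X)); split => //.
- split=> //; split=> i; split=> //.
    by rewrite aQ0; have [_ H _ _ _] := orth_polarP (R := R) (m i);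
      exact/H/(set_valP p0.1).
  by rewrite aS0; have [_ H _ _ _] := orth_polarP (R := R) (n i);
    exact/H/(set_valP p0.2).
- apply: smooth_polar_pair => // [i|j|X [_ [H1 H2]]].
  + by apply: smooth_mono (saQ i) => X [].
  + by apply: smooth_mono (saS j) => X [].
  + by split=> i; [have [] := H1 i|have [] := H2 i].
- by apply: polar_pair_id => i; [exact: aQ0|exact: aS0].
- move=> X [WX _] [OX co ro].
  have [XX' XX] := (O_unblock X).1 OX.
  pose Z i j := Rblock e p0 i j *m sval (cid (polarP i j)) ((Y i j X)^T *m Y i
    j X).
  have QE i j : Q i j X = submxblock (unblock X) i j *m Z i j.
    rewrite /Z mulmxA /Q; case: cid => isq [_ _ _ _ [polE _]] /=.
    exact: polE.
  have oQ i j : orthonormal_cols (submxblock (unblock X) i j *m Z i j).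
    rewrite -QE /Q; have [isq [_ _ _ H _]] := polarP i j.
    exact/H/WX.
  have fQ := frames_Q co oQ; have fS := frames_S XX' co ro oQ.
  have fQS := frames_QS co filling_row oQ.
  apply: eq_Phi_blocks => i j.
  have [||-> ->] := @assemble_blocks (fun i j => Q i j X) (fun i j =>
    S i j X) _ _ i j.
  + by move=> i'; have := fQ i'; under eq_mxrow do rewrite -QE.
  + by move=> j'; have := fS j'; under eq_mxrow do rewrite -QE.
  + by rewrite -fQS /S -!QE.
Qed.

End Filling.

(** For fixed [i] the projections [X_ij *m X_ij^T] onto the column spaces of the
blocks add up to the identity of size [m i]; comparing traces, their ranks add
up to [m i]. The same holds for the rows, so the ranks form a perfect
filling. *)
Lemma Phi_surjective (X : 'M[R]_N) : block_orthogonal X ->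
  exists e p, Phi (R := R) (m := m) (n := n) e hm hn p = X.
Proof.
move=> [OX co ro]; have [XX' XX] := (O_unblock X).1 OX.
have fr i j := partial_isometry_frame (block_partial_isometry XX' co i j).
pose r i j := sval (cid (fr i j)).
have rP i j : exists Z : 'M[R]_(n j, r i j),
    orthonormal_cols (submxblock (unblock X) i j *m Z) /\
    \tr (submxblock (unblock X) i j *m (submxblock (unblock X) i j)^T) =
      (r i j)%:R.
  exact: svalP (cid (fr i j)).
pose E : 'M[nat]_(s, t) := \matrix_(i, j) r i j.
have EP : perfect_filling m n E.
  split=> [i|j]; apply/eqP; rewrite -(eqr_nat R) natr_sum; apply/eqP.
    rewrite -(mxtrace1 R (m i)) -(block_row_sum XX' i) [RHS]raddf_sum.
    by apply: eq_bigr => j _ /=; have [Z [_ tr]] := rP i j; rewrite tr mxE.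
  rewrite -(mxtrace1 R (n j)) -(block_col_sum XX j) [RHS]raddf_sum.
  by apply: eq_bigr => i _ /=; have [Z [_ tr]] := rP i j;
    rewrite mxtrace_mulC tr mxE.
pose e : perfect_filling m n := exist _ E (mem_set EP).
have ZP i j : exists Z : 'M[R]_(n j, \val e i j),
    orthonormal_cols (submxblock (unblock X) i j *m Z).
  by rewrite /= mxE; have [Z [oZ _]] := rP i j; exists Z.
pose Z i j := sval (cid (ZP i j)).
have oQ i j : orthonormal_cols (submxblock (unblock X) i j *m Z i j).
  exact: svalP (cid (ZP i j)).
exists e.
have fQ := frames_Q co oQ; have fS := frames_S XX' co ro oQ.
have fQS := frames_QS co (filling_row e) oQ.
pose Q i j := submxblock (unblock X) i j *m Z i j.
exists (polar_pair (assembleQ Q) (assembleS (fun i j =>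
  (submxblock (unblock X) i j)^T *m Q i j))).
apply: eq_Phi_blocks => i j.
by have [-> ->] := assemble_blocks fQ fS i j; rewrite fQS.
Qed.

(** The entry [(i, j)] of the filling is the trace of [X_ij *m X_ij^T]. *)
Lemma Phi_filling (e e' : perfect_filling m n) (p q : G) :
  Phi e hm hn p = Phi e' hm hn q -> e = e'.
Proof.
move=> pq; apply: val_inj; apply/matrixP => i j; apply/eqP;
  rewrite -(eqr_nat R).
rewrite -(frame_trace (Qblock_orthonormal e p i j) (Rblock_orthonormal e p i
  j)).
rewrite -(frame_trace (Qblock_orthonormal e' q i j) (Rblock_orthonormal e' q i
  j)).
by rewrite -!Phi_block pq.
Qed.

End PhiMap.

(** * Orbit spaces *)

Section OrbitSpaces.
Local Open Scope quotient_scope.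
Context {R : realType} {s t : nat} {m : 'I_s -> nat} {n : 'I_t ->
  nat} {N : nat}.
Variables (hm : (\sum_i m i)%N = N) (hn : (\sum_j n j)%N = N).

Local Notation G := (Oprod R m * Oprod R n)%type.

Definition Phi_orbit (e : perfect_filling m n) (x : orbit_space (R :=
  R) e) : 'M[R]_N :=
  Phi e hm hn (repr x).

Lemma orbit_proj_surjective (e : perfect_filling m n) (x : orbit_space (R :=
  R) e) :
  exists p : G, orbit_proj e p = x.
Proof. by exists (repr x); exact: reprK. Qed.

Lemma Phi_orbit_proj (e : perfect_filling m n) (p : G) :
  Phi_orbit (orbit_proj e p) = Phi e hm hn p.
Proof.
apply: same_orbit_Phi; apply/(@eqquotP _ (same_orbit_equivRel (R := R) e)).
exact: reprK.
Qed.

Lemma Phi_orbit_injective (e : perfect_filling m n) :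
  injective (@Phi_orbit e).
Proof.
move=> x y; have [p <-] := orbit_proj_surjective x.
have [q <-] := orbit_proj_surjective y.
rewrite !Phi_orbit_proj => /Phi_same_orbit pq.
exact/(@eqquotP _ (same_orbit_equivRel (R := R) e)).
Qed.

Lemma orbit_proj_continuous (e : perfect_filling m n) :
  continuous (@orbit_proj R s t m n e).
Proof. exact: pi_continuous. Qed.

Lemma Phi_orbit_continuous (e : perfect_filling m n) : continuous (@Phi_orbit
  e).
Proof.
apply/quotient_continuous.
have -> : @Phi_orbit e \o \pi_(orbit_space e) = Phi_ext hm hn e \o
  @diag_embed R s t m n.
  apply/funext => p /=; rewrite Phi_extE -Phi_orbit_proj //.
have [ci _ _] := @diag_embed_embedding R s t m n.
move=> p; apply: continuous_comp; first exact: ci.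
exact: smooth_continuous (smooth_Phi_ext hm hn e) _.
Qed.

Lemma Phi_orbit_sections (e : perfect_filling m n) (p : G) :
  exists (W : set 'M[R]_N) (sigma : 'M[R]_N -> G),
  [/\ open W, W (Phi_orbit (orbit_proj e p)),
    smooth_on W (@diag_embed R s t m n \o sigma),
      sigma (Phi_orbit (orbit_proj e p)) = p &
      forall x, W (Phi_orbit x) ->
        Phi_orbit (orbit_proj e (sigma (@Phi_orbit e x))) = Phi_orbit x].
Proof.
have [W [sigma [oW Wp ss sp sX]]] := Phi_section hm hn e p.
exists W, sigma; rewrite !Phi_orbit_proj; split=> // x Wx.
by rewrite Phi_orbit_proj; apply: sX => //; exact: Phi_block_orthogonal.
Qed.

Lemma orbit_structureP (e : perfect_filling m n) (Q : set (chart R (orbit_space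
  e))) :
  quotient_structure Q <-> Q = embedded_atlas (@Phi_orbit e).
Proof.
apply: (@quotient_structure_unique R G (orbit_space e) _ 'M[R]_N (@diag_embed R
  s t m n)
  (@Phi_orbit e) (@orbit_proj R s t m n e) (Phi_ext hm hn e)).
- exact: findim_EG.
- exact: findim_mx.
- exact: diag_embed_embedding.
- exact: diag_embed_retract.
- exact: orbit_proj_continuous.
- exact: orbit_proj_surjective.
- exact: Phi_orbit_continuous.
- exact: Phi_orbit_injective.
- exact: smooth_Phi_ext.
- by move=> p; rewrite Phi_extE Phi_orbit_proj.
- exact: Phi_orbit_sections.
Qed.

Lemma orbit_charts (e : perfect_filling m n) (x : orbit_space e) :
  exists2 c, embedded_atlas (@Phi_orbit e) c & dom c x.
Proof.
have [[_ _ + _ _] _] := (orbit_structureP (embedded_atlas (@Phi_orbit e))).2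
  erefl.
exact.
Qed.

Definition Phi_coproduct := coproduct_map (@Phi_orbit).

Lemma Phi_coproduct_injective : injective Phi_coproduct.
Proof.
move=> [e x] [e' y]; rewrite /Phi_coproduct /coproduct_map /=.
have [p px] := orbit_proj_surjective x; have [q qy] := orbit_proj_surjective y.
move=> E; have ee : e = e'.
  by apply: (@Phi_filling _ _ _ _ _ _ hm hn _ _ p q);
    rewrite -!Phi_orbit_proj px qy.
by subst e'; congr existT; exact: Phi_orbit_injective E.
Qed.

Lemma Phi_coproduct_block_orthogonal x : block_orthogonal hm hn (Phi_coproduct
  x).
Proof. exact: Phi_block_orthogonal. Qed.

Lemma Phi_coproduct_surjective X : block_orthogonal hm hn X ->
  exists x, Phi_coproduct x = X.
Proof.
move=> /Phi_surjective[e [p <-]].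
by exists (existT _ e (orbit_proj e p)); exact: Phi_orbit_proj.
Qed.

(** The local section through a point of one orbit space takes all nearby
block-orthogonal matrices to the same orbit space, so the orbit spaces have open
images. *)
Lemma Phi_coproduct_embedding : embedding Phi_coproduct.
Proof.
split; last 2 first.
- exact: Phi_coproduct_injective.
- move=> [e x] U nU; have [p px] := orbit_proj_surjective x; subst x.
  have [W [sigma [oW Wp ss sp sX]]] := Phi_section hm hn e p.
  have [_ _ ind] : embedding (@Phi_orbit e).
    apply: (@quotient_embedding R G (orbit_space e) _ 'M[R]_N (@diag_embed R s
      t m n)
      (@Phi_orbit e) (@orbit_proj R s t m n e)).
    + exact: diag_embed_embedding.
    + exact: orbit_proj_continuous.
    + exact: orbit_proj_surjective.
    + exact: Phi_orbit_continuous.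
    + exact: Phi_orbit_injective.
    + exact: Phi_orbit_sections.
  have nU' : nbhs (orbit_proj e p) (existT (fun e => orbit_space (R :=
    R) e) e @^-1` U).
    exact: nU.
  have {}ind := ind _ _ nU'.
  rewrite -(Phi_orbit_proj e p) in Wp.
  apply: (@filterS2 _ (nbhs (Phi_orbit (orbit_proj e p))) _ _ _ _ _
    (open_nbhs_nbhs (conj oW Wp)) ind) => z Wz Hz y yz.
  have zE : Phi e hm hn (sigma z) = z.
    by apply: sX => //; rewrite -yz; exact: Phi_coproduct_block_orthogonal.
  have -> : y = existT _ e (orbit_proj e (sigma z)).
    apply: Phi_coproduct_injective; rewrite yz -{1}zE.
    by rewrite /Phi_coproduct /coproduct_map /= Phi_orbit_proj.
  by apply: Hz; rewrite Phi_orbit_proj.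
- move=> [e x] U nU; have := @Phi_orbit_continuous e x U nU.
  exact.
Qed.

End OrbitSpaces.

(** * The critical locus *)

Theorem theorem2p8 (R : realType) (N s t : nat) (hN : (1 <= N)%N)
  (m : 'I_s -> nat) (n : 'I_t -> nat) (a : 'I_s -> R) (b : 'I_t -> R)
  (a_inj : injective a) (b_inj : injective b)
  (m_ge1 : forall i, (1 <= m i)%N) (n_ge1 : forall j, (1 <= n j)%N)
  (hm : (\sum_i m i)%N = N) (hn : (\sum_j n j)%N = N) :
  let A : 'M[R]_N := castmx (hm, hm) (\mxdiag_i (a i)%:M) in
  let B : 'M[R]_N := castmx (hn, hn) (\mxdiag_j (b j)%:M) in
  let F : set (O R N) := critical_locus A B in
  let F_atlas : set (chart R F) :=
    embedded_atlas (fun X : F => \val (\val X)) in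
  (forall e : perfect_filling m n,
     exists! Q : set (chart R (orbit_space e)), quotient_structure Q) /\
  smooth_structure F_atlas /\
  forall Q : forall e : perfect_filling m n, set (chart R (orbit_space e)),
    (forall e, quotient_structure (Q e)) ->
    exists Phi_bar : {e : perfect_filling m n & orbit_space e} -> F,
      (forall e p, \val (\val (Phi_bar (existT _ e (orbit_proj e p)))) =
                   Phi e hm hn p) /\
      diffeomorphism (coproduct_atlas Q) F_atlas Phi_bar.
Proof.
move=> A B F F_atlas.
have critP (X : O R N) : F X <-> block_orthogonal hm hn (\val X).
  exact: critical_locus_blocks.
have fM : findim 'M[R]_N by exact: findim_mx.
have eF : embedding (fun X : F => \val (\val X)).
  exact: embedding_trans (embedding_set_val F) (@O_embedding R N).
have liftF Y : block_orthogonal hm hn Y -> exists X : F, \val (\val X) = Y.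
  move=> bY; have [OY _ _] := bY.
  pose X : O R N := exist _ Y (mem_set OY).
  have FX : F X by apply/critP.
  by exists (exist _ X (mem_set FX)).
have bF (X : F) : block_orthogonal hm hn (\val (\val X)).
  by apply/critP; exact: set_valP.
split=> [e|]; last split.
- exists (embedded_atlas (Phi_orbit hm hn (e := e))).
  split; first exact/(orbit_structureP hm hn).
  by move=> Q /(orbit_structureP hm hn).
- apply: embedded_smooth_structure => // X.
  have [e [p pX]] := Phi_surjective (bF X).
  have [W [sigma [oW Wp ss sp sX]]] := Phi_section hm hn e p.
  exists W, (Phi_ext hm hn e \o (@diag_embed R s t m n \o sigma)); split=> //.
  + by rewrite -pX.
  + apply: (smooth_comp (@findim_EG R s t m n) oW openT) => //.
    exact: smooth_Phi_ext.
  + move=> z _; have [Y YE] := liftF _ (Phi_block_orthogonal hm hn e (sigma z)).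
    by exists Y; rewrite YE /= Phi_extE.
  + by move=> Y WY; rewrite -[LHS]/(Phi_ext hm hn e (diag_embed (sigma _)))
    Phi_extE; exact: sX (bF Y).
move=> Q hQ.
have QE : Q = fun e => embedded_atlas (Phi_orbit hm hn (e := e)).
  by apply: functional_extensionality_dep => e; exact/(orbit_structureP hm hn).
have lift x : exists X : F, \val (\val X) = Phi_coproduct hm hn x.
  by apply: liftF; exact: Phi_coproduct_block_orthogonal.
have lower (X : F) : exists x, Phi_coproduct (R := R) hm hn x = \val (\val X).
  exact: Phi_coproduct_surjective.
pose Phi_bar x := sval (cid (lift x)).
have Phi_barE x : \val (\val (Phi_bar x)) = Phi_coproduct hm hn x.
  exact: svalP (cid (lift x)).
pose Psi X := sval (cid (lower X)).
have PsiE X : Phi_coproduct hm hn (Psi X) = \val (\val X).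
  exact: svalP (cid (lower X)).
exists Phi_bar; split=> [e p|].
  by rewrite Phi_barE; exact: Phi_orbit_proj.
have eP := Phi_coproduct_embedding (R := R) hm hn.
rewrite QE coproduct_embedded_atlas //; last exact: orbit_charts.
apply: (embedded_diffeomorphism (g := Psi)) => //.
- by move=> x; apply: (@Phi_coproduct_injective _ _ _ _ _ _ hm hn);
  rewrite PsiE Phi_barE.
- by move=> X; do 2 apply: val_inj; rewrite Phi_barE PsiE.
Qed.
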